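(* Let $\mathcal{I}:I\to\mathbb{R}$ be a $d$-dimensional grayscale digital image, let $N>\max_{p\in I}\mathcal{I}(p)$, and let $\mathcal{I}^{\mathbf{P}}$ be the image padded with the value $N$. Then, as multisets of intervals labelled by homological degree, $$\mathsf{Dgm}_{\mathbf F}(T(\mathcal{I}))=\{\,[-q,-p)_{d-k-1}\mid [p,q)_k\in\mathsf{Dgm}_{\mathbf F}(V(-\mathcal{I}^{\mathbf P}))\,\}\setminus\{\,[\min\mathcal{I},N)_0\,\}$$ and $$\mathsf{Dgm}_\infty(T(\mathcal{I}))=\{\,[\min\mathcal{I},\infty)_0\,\}.$$
   Context: A $d$-dimensional grayscale digital image ($d\ge 1$) is a function $\mathcal{I}:I\to\mathbb{R}$ with $I=\{1,\dots,n_1\}\times\dots\times\{1,\dots,n_d\}$. For a real $N>\max\mathcal{I}$, the padded image $\mathcal{I}^{\mathbf P}:I^{\mathbf P}\to\mathbb{R}$ has domain $I^{\mathbf P}=\{0,\dots,n_1+1\}\times\dots\times\{0,\dots,n_d+1\}$, with $\mathcal{I}^{\mathbf P}(p)=\mathcal{I}(p)$ for $p\in I$ and $\mathcal{I}^{\mathbf P}(p)=N$ for $p\in I^{\mathbf P}\setminus I$. $-\mathcal{I}^{\mathbf P}$ is its pointwise negative. An elementary $k$-cube in $\mathbb{R}^d$ is a product of $d$ intervals, $k$ of the form $[l,l+1]$ and $d-k$ degenerate $[l,l]$. For cells, $\tau\preceq\sigma$ means $\tau$ is a face of $\sigma$. V-construction: for an image $\mathcal{J}:J\to\mathbb{R}$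 on a grid $J$ of size $(m_1,\dots,m_d)$, $V(J)$ is the cubical complex of the array of $(m_1-1)\times\dots\times(m_d-1)$ elementary $d$-cubes and all their faces, whose vertices are indexed exactly by $J$ (the unit-cube subdivision of the box spanned by $J$). The function $V(\mathcal{J})$ equals $\mathcal{J}(p)$ on the vertex indexed by $p$, and on a cube $\sigma$ equals the maximum of its values on the vertices of $\sigma$. T-construction: $T(J)$ is the cubical complex of the array of $m_1\times\dots\times m_d$ elementary $d$-cubes and all their faces, whose $d$-cubes are indexed exactly by $J$ (up to translation, the cube indexed by $p$ is $\prod_i[p_i-\frac12,p_i+\frac12]$). The function $T(\mathcal{J})$ equals $\mathcal{J}(p)$ on the $d$-cube indexed by $p$, and on a cube $\sigma$ equals the minimum of its values on the $d$-cubes having $\sigma$ as a face. Persistence diagrams: for a function $f:X\to\mathbb{R}$ on the cells of a finite cell complex with $f(\sigma)\le f(\tau)$ whenever $\sigma\preceq\tau$, the sub-level sets $f^{-1}(-\infty,r]$ are subcomplexes, and the functor $H_k(f):r\mapsto H_k(f^{-1}(-\infty,r];\mathbb{Z}/2\mathbb{Z})$ on the poset $(\mathbb{R},\le)$ decomposes as a direct sum of interval modules $\mathbb{I}_{[b_l,d_l)}$, $l \in L$ ($\mathbb{Z}/2\mathbb{Z}$ on $[b_l,d_l)$ with identity maps, $0$ elsewhere), with $d_l\in\mathbb{R}\cup\{\infty\}$. $\mathsf{Dgm}^k(f)$ is the multiset of intervals $[b_l,d_l)$ so obtained, also written $[b_l,d_l)_k$, and $\mathsf{Dgm}(f)=\bigsqcup_k\mathsf{Dgm}^k(f)$.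 $\mathsf{Dgm}_{\mathbf F}(f)$ is the sub-multiset of finite intervals ($d_l<\infty$) and $\mathsf{Dgm}_\infty(f)$ that of the intervals with $d_l=\infty$. Empty intervals are neglected. The set operation $\setminus$ and the set-builder notation are to be read for multisets (removing one copy). $\mathsf{Dgm}(T(\mathcal{I}))$ is the diagram of the function $T(\mathcal{I})$ on $T(I)$, and $\mathsf{Dgm}(V(-\mathcal{I}^{\mathbf P}))$ is that of $V(-\mathcal{I}^{\mathbf P})$ on $V(I^{\mathbf P})$. *)

(* Defs.v *)
From HB Require Import structures.
From mathcomp Require Import all_boot all_order all_algebra.
From mathcomp Require Import generic_quotient ring_quotient.
From mathcomp Require Import reals constructive_ereal.

Set Implicit Arguments.
Unset Strict Implicit.
Unset Printing Implicit Defensive.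

Import Order.TTheory GRing.Theory Num.Theory.
Local Open Scope ring_scope.

(* [quotv U W] is the quotient of [U] by [U :&: W]. It is only used with
   [W <= U]. *)
Section QuotientSpace.
Variables (K : fieldType) (vT : vectType K) (U W : {vspace vT}).
Local Open Scope quotient_scope.

Definition quot_ker : {pred subvs_of U} := [pred u | vsval u \in W].

Fact quot_ker_zmod_closed : zmod_closed quot_ker.
Proof.
by split=> [|u v]; rewrite !inE ?raddf0 ?mem0v // => uW vW; rewrite raddfB memvB.
Qed.
HB.instance Definition _ :=
  GRing.isZmodClosed.Build (subvs_of U) quot_ker quot_ker_zmod_closed.

Definition quotv := Quotient.quot quot_ker.

HB.instance Definition _ := Choice.on quotv.
HB.instance Definition _ : EqQuotient _ (Quotient.equiv quot_ker) quotv :=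
  EqQuotient.on quotv.
HB.instance Definition _ := GRing.Zmodule.on quotv.
HB.instance Definition _ :
  isZmodQuotient _ (Quotient.equiv quot_ker) 0 -%R +%R quotv :=
  ZmodQuotient.on quotv.

Definition quotv_scale (a : K) (x : quotv) : quotv := \pi_quotv (a *: repr x).

Lemma quotv_eq (u v : subvs_of U) :
  (\pi_quotv u = \pi_quotv v) <-> (vsval u - vsval v \in W).
Proof.
rewrite -raddfB; split=> [/eqP|uvW].
  by rewrite -Quotient.idealrBE.
by apply/eqP; rewrite -Quotient.idealrBE.
Qed.

Lemma quotv_piZ a u : quotv_scale a (\pi_quotv u) = \pi_quotv (a *: u).
Proof.
apply/quotv_eq; rewrite (_ : _ - _ = a *: (vsval (repr (\pi_quotv u)) - vsval u)).
  by apply: memvZ; apply/quotv_eq; rewrite reprK.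
by rewrite scalerBr.
Qed.

Fact quotv_scaleA a b x :
  quotv_scale a (quotv_scale b x) = quotv_scale (a * b) x.
Proof. by rewrite -[x]reprK (quotv_piZ b) !quotv_piZ scalerA. Qed.

Fact quotv_scale1 : left_id 1 quotv_scale.
Proof. by move=> x; rewrite -[x]reprK quotv_piZ scale1r. Qed.

Fact quotv_scaleDr : right_distributive quotv_scale +%R.
Proof.
move=> a x y; rewrite -[x]reprK -[y]reprK -raddfD !quotv_piZ -raddfD.
by rewrite scalerDr.
Qed.

Fact quotv_scaleDl x : {morph quotv_scale^~ x : a b / a + b}.
Proof. by move=> a b; rewrite -[x]reprK !quotv_piZ -raddfD scalerDl. Qed.

HB.instance Definition _ := GRing.Zmodule_isLmodule.Build K quotv
  quotv_scaleA quotv_scale1 quotv_scaleDr quotv_scaleDl.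

Definition quotv_class (u : subvs_of U) : quotv := \pi_quotv u.

End QuotientSpace.

Section QuotientMap.
Variables (K : fieldType) (vT : vectType K).

(* [u + W |-> u + W'] *)
Definition quotv_map (U W U' W' : {vspace vT}) & (U <= U')%VS & (W <= W')%VS :=
  fun x : quotv U W => quotv_class W' (vsproj U' (vsval (repr x))).

Variables (U W U' W' : {vspace vT}) (sU : (U <= U')%VS) (sW : (W <= W')%VS).

Lemma quotv_mapE u : quotv_map sU sW (quotv_class W u)
                     = quotv_class W' (vsproj U' (vsval u)).
Proof.
apply/quotv_eq; rewrite !vsprojK ?(subvP sU) ?subvsP //; apply: (subvP sW).
by apply/quotv_eq; rewrite reprK.
Qed.

Fact quotv_map_linear : linear (quotv_map sU sW).
Proof.
move=> a x y; rewrite -[x]reprK -[y]reprK.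
rewrite -![\pi_(_)%qT _]/(quotv_class W _).
have lin V V' b (u v : subvs_of V) : b *: quotv_class V' u + quotv_class V' v
    = quotv_class V' (b *: u + v).
  by rewrite /quotv_class raddfD; congr (_ + _); apply: quotv_piZ.
by rewrite lin !quotv_mapE lin !linearP.
Qed.
HB.instance Definition _ := GRing.isLinear.Build K (quotv U W) (quotv U' W') _
  (quotv_map sU sW) quotv_map_linear.

End QuotientMap.

Section PersistenceModules.
Variable R : realType.

(* A functor from the poset (R, <=) to vector spaces over Z/2. *)
Record pmodule := PModule {
  pspace :> R -> lmodType 'F_2;
  pmap : forall r s : R, r <= s -> {linear pspace r -> pspace s};
  pmap_id : forall r (rr : r <= r) x, pmap rr x = x;
  pmap_comp : forall r s t (rs : r <= s) (st : s <= t) (rt : r <= t) x,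
    pmap rt x = pmap st (pmap rs x)
}.

Definition pmodule_iso (M N : pmodule) : Prop :=
  exists phi : forall r, {linear M r -> N r},
    (forall r, bijective (phi r)) /\
    (forall r s (rs : r <= s) x,
       phi s (pmap M rs x) = pmap N rs (phi r x)).

Section DirectSum.
Variables M N : pmodule.

Definition sum_map r s (rs : r <= s) (x : M r * N r) : M s * N s :=
  (pmap M rs x.1, pmap N rs x.2).

Fact sum_map_linear r s (rs : r <= s) : linear (sum_map rs).
Proof. by move=> a x y; rewrite /sum_map /= !linearP. Qed.
HB.instance Definition _ r s (rs : r <= s) :=
  GRing.isLinear.Build 'F_2 (M r * N r)%type (M s * N s)%type _
    (sum_map rs) (sum_map_linear rs).

Fact sum_map_id r (rr : r <= r) x : sum_map rr x = x.
Proof. by case: x => x y; rewrite /sum_map /= !pmap_id. Qed.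

Fact sum_map_comp r s t (rs : r <= s) (st : s <= t) (rt : r <= t) x :
  sum_map rt x = sum_map st (sum_map rs x).
Proof. by rewrite /sum_map /= -!pmap_comp. Qed.

Definition pmodule_add : pmodule :=
  @PModule (fun r => (M r * N r)%type : lmodType 'F_2)
    (fun r s rs => sum_map rs) sum_map_id sum_map_comp.
End DirectSum.

(* The interval [b, d); [d = +oo] encodes an infinite interval. *)
Definition bar : Type := (R * \bar R)%type.

Definition in_bar (J : bar) (r : R) : bool :=
  (J.1 <= r) && (r%:E < J.2)%E.

Definition bar_nonempty (J : bar) : bool := (J.1%:E < J.2)%E.

(* (Z/2)^1 inside [J], (Z/2)^0 outside; [pid_mx 1] is the identity matrix
   between two copies of (Z/2)^1. *)
Section IntervalModule.
Variable J : bar.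

Definition bar_map r s (_ : r <= s) :
    {linear 'rV['F_2]_(in_bar J r) -> 'rV['F_2]_(in_bar J s)} :=
  mulmxr (pid_mx 1).

Fact bar_map_id r (rr : r <= r) x : bar_map rr x = x.
Proof.
move: x; rewrite /bar_map /mulmxr /=; case: (in_bar J r) => /= x.
  by rewrite pid_mx_1 mulmx1.
by rewrite !thinmx0.
Qed.

Fact bar_map_comp r s t (rs : r <= s) (st : s <= t) (rt : r <= t) x :
  bar_map rt x = bar_map st (bar_map rs x).
Proof.
have conv : in_bar J r -> in_bar J t -> in_bar J s.
  case/andP=> br _ /andP[_ td]; rewrite /in_bar (le_trans br rs) /=.
  by apply: le_lt_trans td; rewrite lee_fin.
move: x conv; rewrite /bar_map /=.
case: (in_bar J r) => /= x; last by rewrite !thinmx0 !mul0mx.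
case: (in_bar J t) => /= [/(_ isT isT) -> | _]; last by rewrite !thinmx0.
by rewrite /= pid_mx_1 !mulmx1.
Qed.

Definition bar_module : pmodule :=
  @PModule (fun r => 'rV['F_2]_(in_bar J r) : lmodType 'F_2)
    bar_map bar_map_id bar_map_comp.
End IntervalModule.

(* The interval module of an empty interval is zero. *)
Definition pmodule0 : pmodule := bar_module (0, 0%:E).

Definition pmodule_sum (s : seq pmodule) : pmodule :=
  foldr pmodule_add pmodule0 s.

End PersistenceModules.

Section CubicalComplex.
Variable d : nat.

(* Elementary intervals [l, l + 1] (encoded as [(l, true)]) and [l, l]
   (encoded as [(l, false)]) contained in [0, a]. *)
Definition eitv (a : nat) : Type :=
  {x : 'I_a.+1 * bool | (x.1 + x.2 <= a)%N}.
HB.instance Definition _ a := SubFinite.on (eitv a).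

Definition eitv_left a (x : eitv a) : nat := (val x).1.
Definition eitv_right a (x : eitv a) : nat := ((val x).1 + (val x).2)%N.
Definition eitv_dim a (x : eitv a) : nat := (val x).2.

Fact point_eitv_proof m (l : 'I_m) : (l < m.-1.+1)%N.
Proof. by case: m l => [[]|m l] //=. Qed.

Fact point_eitv_le m (l : 'I_m) :
  (Ordinal (point_eitv_proof l) + false <= m.-1)%N.
Proof. by rewrite addn0 -ltnS; apply: point_eitv_proof. Qed.

Fact unit_eitv_le m (l : 'I_m) : (widen_ord (leqnSn m) l + true <= m)%N.
Proof. by rewrite addn1; apply: (ltn_ord l). Qed.

Definition point_eitv m (l : 'I_m) : eitv m.-1 :=
  Sub (Ordinal (point_eitv_proof l), false) (point_eitv_le l).

Definition unit_eitv m (l : 'I_m) : eitv m :=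
  Sub (widen_ord (leqnSn m) l, true) (unit_eitv_le l).

(* The elementary cubes contained in the box [0, a_1] x ... x [0, a_d]. *)
Definition cube (a : 'I_d -> nat) : Type := {dffun forall i, eitv (a i)}.
HB.instance Definition _ a := Finite.on (cube a).

Section Cubes.
Variable a : 'I_d -> nat.

Definition cube_dim (s : cube a) : nat := (\sum_i eitv_dim (s i))%N.

Definition cube_face (t s : cube a) : bool :=
  [forall i, (eitv_left (s i) <= eitv_left (t i))%N &&
             (eitv_right (t i) <= eitv_right (s i))%N].

Definition cube_facet (t s : cube a) : bool :=
  cube_face t s && (cube_dim s == (cube_dim t).+1).

(* Chains with coefficients in Z/2, in all degrees at once. *)
Definition chain : Type := {ffun cube a -> ('F_2)^o}.
HB.instance Definition _ := Vector.on chain.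

Definition bd (c : chain) : chain :=
  [ffun t => \sum_(s | cube_facet t s) c s].

Fact bd_linear : linear bd.
Proof.
move=> x c c'; apply/ffunP=> t; rewrite !ffunE scaler_sumr -big_split /=.
by apply: eq_bigr => s _; rewrite !ffunE.
Qed.
HB.instance Definition _ := GRing.isLinear.Build 'F_2 chain chain _ bd bd_linear.

Definition cube_chain (s : cube a) : chain := [ffun t => (t == s)%:R].

(* Degrees are integers, so that [d - k - 1] needs no truncation; the chain
   spaces of negative degree are zero. *)
Definition chains (X : {set cube a}) (k : int) : {vspace chain} :=
  <<[seq cube_chain s | s <- enum X & (cube_dim s)%:Z == k]>>%VS.

Definition cycles (X : {set cube a}) (k : int) : {vspace chain} :=
  (chains X k :&: lker (linfun bd))%VS.

Definition boundaries (X : {set cube a}) (k : int) : {vspace chain} :=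
  (linfun bd @: chains X (k + 1))%VS.

Definition homology (X : {set cube a}) (k : int) : lmodType 'F_2 :=
  quotv (cycles X k) (boundaries X k).

Fact chainsS (X Y : {set cube a}) k :
  X \subset Y -> (chains X k <= chains Y k)%VS.
Proof.
move=> sXY; apply: sub_span => c /mapP[s]; rewrite mem_filter mem_enum.
case/andP=> sk sX ->; apply: map_f; rewrite mem_filter sk mem_enum.
exact: (subsetP sXY).
Qed.

Fact cyclesS (X Y : {set cube a}) k :
  X \subset Y -> (cycles X k <= cycles Y k)%VS.
Proof. by move=> sXY; apply: capvS => //; apply: chainsS. Qed.

Fact boundariesS (X Y : {set cube a}) k :
  X \subset Y -> (boundaries X k <= boundaries Y k)%VS.
Proof. by move=> sXY; apply: limgS; apply: chainsS. Qed.

Section SublevelPersistence.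
Variables (R : realType) (f : cube a -> R) (k : int).

Definition sublevel (r : R) : {set cube a} := [set s | f s <= r].

Fact sublevelS r s : r <= s -> sublevel r \subset sublevel s.
Proof. by move=> rs; apply/subsetP=> c; rewrite !inE => /le_trans; apply. Qed.

(* Induced by the inclusion of [sublevel r] into [sublevel s]. *)
Definition homology_map r s (rs : r <= s) :
    {linear homology (sublevel r) k -> homology (sublevel s) k} :=
  quotv_map (cyclesS k (sublevelS rs)) (boundariesS k (sublevelS rs)).

Fact homology_map_id r (rr : r <= r) x : homology_map rr x = x.
Proof. by rewrite -[x]reprK [LHS]quotv_mapE vsvalK. Qed.

Fact homology_map_comp r s t (rs : r <= s) (st : s <= t) (rt : r <= t) x :
  homology_map rt x = homology_map st (homology_map rs x).
Proof.
rewrite -[x]reprK [LHS]quotv_mapE [homology_map rs _]quotv_mapE.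
rewrite [RHS]quotv_mapE vsprojK //.
exact/(subvP (cyclesS k (sublevelS rs)))/subvsP.
Qed.

Definition persistent_homology : pmodule R :=
  @PModule R (fun r => homology (sublevel r) k)
    homology_map homology_map_id homology_map_comp.
End SublevelPersistence.

End Cubes.
End CubicalComplex.

(* Multisets of intervals labelled by a degree are represented by sequences, up
   to [perm_eq]. *)
Section Diagrams.
Variable R : realType.

Definition lbar : Type := (int * bar R)%type.
HB.instance Definition _ := Choice.on lbar.

Definition is_dgm d (a : 'I_d -> nat) (f : cube a -> R) (D : seq lbar) : Prop :=
  all (fun x => bar_nonempty x.2) D /\
  forall k : int, pmodule_iso (persistent_homology f k)
    (pmodule_sum [seq bar_module x.2 | x <- D & x.1 == k]).

Definition dgm_fin (D : seq lbar) : seq lbar :=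
  [seq x <- D | (x.2.2 < +oo)%E].

Definition dgm_inf (D : seq lbar) : seq lbar :=
  [seq x <- D | x.2.2 == +oo%E].

(* [p, q)_k |-> [-q, -p)_(d - k - 1), for finite [q] *)
Definition dual_lbar (d : nat) (x : lbar) : lbar :=
  (d%:Z - x.1 - 1, (- fine x.2.2, (- x.2.1)%:E)).

End Diagrams.

Section Images.
Variables (R : realType) (d : nat).

(* Maximum and minimum of [F] over the elements satisfying [P]; 0 if there
   are none. *)
Definition max_over (T : finType) (P : pred T) (F : T -> R) : R :=
  if [pick x | P x] is Some x0 then \big[Num.max/F x0]_(x | P x) F x else 0.

Definition min_over (T : finType) (P : pred T) (F : T -> R) : R :=
  if [pick x | P x] is Some x0 then \big[Num.min/F x0]_(x | P x) F x else 0.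

(* All grids are indexed from 0. *)
Definition grid (m : 'I_d -> nat) : Type := {dffun forall i, 'I_(m i)}.
HB.instance Definition _ m := Finite.on (grid m).

Definition gsimage (m : 'I_d -> nat) : Type := grid m -> R.

(* The pixel [q] of the original image becomes the pixel [q + (1, ..., 1)]. *)
Definition pad (n : 'I_d -> nat) (I : gsimage n) (N : R) :
    gsimage (fun i => (n i).+2) :=
  fun p => if [pick q : grid n | [forall i, p i == (q i).+1 :> nat]] is Some q
           then I q else N.

Definition negim (m : 'I_d -> nat) (J : gsimage m) : gsimage m := fun p => - J p.

Section Constructions.
Variables (m : 'I_d -> nat) (J : gsimage m).

(* The vertex indexed by [p] is the point [p]. *)
Definition Vvertex (p : grid m) : cube (fun i => (m i).-1) :=
  [ffun i : 'I_d => point_eitv (p i)].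

Definition Vfun (s : cube (fun i => (m i).-1)) : R :=
  max_over (fun p => cube_face (Vvertex p) s) J.

(* The d-cube indexed by [p] is the product of the intervals
   [p i, p i + 1]. *)
Definition Tcube (p : grid m) : cube m :=
  [ffun i : 'I_d => unit_eitv (p i)].

Definition Tfun (s : cube m) : R :=
  min_over (fun p => cube_face s (Tcube p)) J.
End Constructions.

End Images.

(* Main.v *)
(* Bars are counted by ranks: the number of bars of degree k alive from r to s is
   the rank of H_k of the inclusion of the r-sublevel into the s-sublevel, and these
   numbers determine the finite bars by inclusion-exclusion.

   The cells of T(I) are in dimension-reversing and face-reversing bijection with the
   cells of V(I^P) which do not lie on the boundary of the box, and for b <= N the
   sublevel of V(-I^P) at -b is the complement of the cells dual to {T(I) < b}.
   The rank of H_k(X) -> H_k(Y) is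
     |X_k| - rk D[all, X_k] - rk D[all, Y_(k+1)] + rk D[not X_k, Y_(k+1)]
   where D is the incidence matrix modulo 2. Dualizing cells transposes these blocks,
   and since the box is acyclic the rank of H_k on {T(I) < a} -> {T(I) < b}
   equals that of reduced H_(d-k-1) on the complements, in the reverse direction.
   Reduction of H_0 removes the infinite bar of V(-I^P). The
   formula stops at b = N, where {T(I) < N} is the whole, acyclic, complex: the
   infinite bar of T(I) is thereby truncated to [min I, N), dual to the bar of the
   boundary sphere of the padded box. *)

From HB Require Import structures.
Require Import Defs.
From mathcomp Require Import all_boot all_order all_algebra.
From mathcomp Require Import reals constructive_ereal zify.

Set Implicit Arguments.
Unset Strict Implicit.
Unset Printing Implicit Defensive.

Import Order.TTheory GRing.Theory Num.Theory.
Local Open Scope ring_scope.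

(** * Ranks of linear maps and of persistence modules *)

Section Rank.
Variable K : fieldType.

(** Homology groups are bare [lmodType] quotients without a dimension, so the rank is witnessed by a
    finite-dimensional [W] that [f \o g] maps isomorphically onto the image of [f]. *)
Definition has_rank (U V : lmodType K) (f : {linear U -> V}) (n : nat) : Prop :=
  exists (W : vectType K) (g : {linear W -> U}),
    [/\ \dim {:W} = n, injective (f \o g) & forall u, exists w, f u = f (g w)].

Lemma dim_injective (W W' : vectType K) (h : {linear W -> W'}) :
  injective h -> (\dim {:W} <= \dim {:W'})%N.
Proof.
move=> hI; have /limg_dim_eq <- : ({:W} :&: lker (linfun h) = 0)%VS.
  apply/eqP; rewrite capfv; apply/lker0P => u v; rewrite !lfunE /=; exact: hI.
exact: dimvS (subvf _).
Qed.

(** Choosing for each [w] a [w'] with the same image under [f] gives a map between the two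
    witnesses; injectivity of [f \o g'] makes it linear, and that of [f \o g] makes it injective. *)
Lemma has_rank_leq (U V : lmodType K) (f : {linear U -> V}) m n :
  has_rank f m -> has_rank f n -> (m <= n)%N.
Proof.
case=> W [g [<- gI _]] [W' [g' [<- gI' surj]]].
have ex w : exists w', f (g w) == f (g' w').
  by have [w' ->] := surj (g w); exists w'.
pose h w := xchoose (ex w).
have hE w : f (g w) = f (g' (h w)) by apply/eqP/(xchooseP (ex w)).
have hlin : linear h.
  move=> a u v; apply: gI' => /=.
  by rewrite -hE !linearP -!hE.
pose hL := GRing.isLinear.Build K W W' _ h hlin.
pose H : {linear W -> W'} := HB.pack h hL.
apply: (@dim_injective _ _ H) => u v /= uv.
by apply: gI => /=; rewrite !hE uv.
Qed.

Lemma has_rank_uniq (U V : lmodType K) (f : {linear U -> V}) m n :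
  has_rank f m -> has_rank f n -> m = n.
Proof.
by move=> fm fn; apply/eqP; rewrite eqn_leq !(has_rank_leq fm fn, has_rank_leq fn fm).
Qed.

Lemma has_rank_iso (U V U' V' : lmodType K) (f : {linear U -> V})
    (f' : {linear U' -> V'}) (a : {linear U -> U'}) (b : {linear V -> V'}) n :
  bijective a -> injective b -> (forall u, b (f u) = f' (a u)) ->
  has_rank f n -> has_rank f' n.
Proof.
case=> a' aK a'K bI ab [W [g [dW gI surj]]].
exists W, (a \o g : {linear W -> U'}); split=> //.
  by move=> u v /=; rewrite -!ab => /bI /gI.
move=> u; have [w fw] := surj (a' u); exists w.
by rewrite /= -ab -fw ab a'K.
Qed.

Lemma has_rank_quotv (vT : vectType K) (U W U' W' : {vspace vT})
    (sU : (U <= U')%VS) (sW : (W <= W')%VS) :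
  has_rank (quotv_map sU sW : {linear quotv U W -> quotv U' W'})
    (\dim U - \dim (U :&: W')).
Proof.
(* The kernel of the map from [U] to [quotv U' W'] is [U :&: W'], and [D] is a complement of it in
   [U]. *)
pose D := (U :\: W')%VS.
have sD : (D <= U)%VS := diffvSl _ _.
pose g (w : subvs_of D) : quotv U W := quotv_class W (vsproj U (vsval w)).
have glin : linear g.
  move=> a u v; rewrite /g !linearP /= /quotv_class raddfD; congr (_ + _).
  exact/esym/quotv_piZ.
pose G : {linear subvs_of D -> quotv U W} :=
  HB.pack g (GRing.isLinear.Build _ _ _ _ g glin).
exists (subvs_of D), G; split.
- by rewrite dimvf -(dimv_cap_compl U W') addKn.
- move=> u v; rewrite /= /g !quotv_mapE => /quotv_eq.
  have uU w : vsval (w : subvs_of D) \in U by apply: (subvP sD); apply: subvsP.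
  rewrite !vsprojK ?(subvP sU) ?vsprojK ?uU // => uv.
  have : vsval u - vsval v \in (D :&: W')%VS.
    by rewrite memv_cap uv andbT memvB ?subvsP.
  by rewrite capv_diff memv0 subr_eq0 => /eqP /val_inj.
move=> x; have : vsval (repr x) \in (D + U :&: W')%VS.
  by rewrite addv_diff_cap subvsP.
move=> /memv_addP[u uD [v vW E]].
exists (Subvs uD); rewrite /= /g -[x in LHS]reprK [LHS]quotv_mapE quotv_mapE.
apply/quotv_eq; have uU := subvP sD _ uD.
rewrite /= !vsprojK ?(subvP sU) ?vsprojK ?subvsP //.
by rewrite E addrAC subrr add0r; move: vW; rewrite memv_cap => /andP[].
Qed.

End Rank.

Section Bars.
Variable R : realType.

Lemma has_rank_sum (M N : pmodule R) r s (rs : r <= s) m n :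
  has_rank (Defs.pmap M rs) m -> has_rank (Defs.pmap N rs) n ->
  has_rank (Defs.pmap (pmodule_add M N) rs) (m + n).
Proof.
case=> W [g [dW gI gs]] [W' [g' [dW' gI' gs']]].
pose h (w : W * W') : M r * N r := (g w.1, g' w.2).
have hlin : linear h by move=> a u v; rewrite /h /= !linearP.
pose H : {linear (W * W')%type -> (M r * N r)%type} :=
  HB.pack h (GRing.isLinear.Build _ _ _ _ h hlin).
exists (W * W')%type, H; split.
- by rewrite !dimvf in dW dW' *; rewrite -dW -dW'.
- move=> [u u'] [v v'] /= [] uv uv'; congr (_, _); [exact: gI | exact: gI'].
move=> [u u']; have [w fw] := gs u; have [w' fw'] := gs' u'.
by exists (w, w'); rewrite /= /sum_map /= fw fw'.
Qed.

Lemma has_rank_bar (J : bar R) r s (rs : r <= s) :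
  has_rank (Defs.pmap (bar_module J) rs) (in_bar J r && in_bar J s).
Proof.
exists ('rV['F_2]_(in_bar J r && in_bar J s)).
exists (mulmxr (pid_mx 1)); rewrite dimvf dim_matrix; split.
- exact: mul1n.
- move=> u v /=; move: u v; case: (in_bar J r); case: (in_bar J s) => /= u v;
  by [rewrite !pid_mx_1 !mulmx1 | rewrite [u]thinmx0 [v]thinmx0].
move=> /=; case: (in_bar J r); case: (in_bar J s) => /= u;
  by [exists u; rewrite pid_mx_1 !mulmx1 | exists 0;
    rewrite ?[u]thinmx0 ?mul0mx ?thinmx0].
Qed.

Lemma has_rank_bars (D : seq (bar R)) r s (rs : r <= s) :
  has_rank (Defs.pmap (pmodule_sum [seq bar_module J | J <- D]) rs)
    (count (fun J => (J.1 <= r) && (s%:E < J.2)%E) D).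
Proof.
elim: D => [|J D IH] /=.
  have E : nat_of_bool (in_bar (0 : R, 0%:E) r && in_bar (0 : R, 0%:E) s) = 0%N; last first.
    by have := has_rank_bar (0, 0%:E) rs; rewrite E.
  by rewrite /in_bar /= lte_fin; case: ltP => //= r0; rewrite leNgt r0.
apply: (@has_rank_sum (bar_module J) _ r s rs _ _ _ IH).
suff -> : (J.1 <= r) && (s%:E < J.2)%E = in_bar J r && in_bar J s.
  exact: has_rank_bar.
rewrite /in_bar; case: (boolP (J.1 <= r)) => //= Jr.
rewrite (le_trans Jr rs) /=; case: (boolP (s%:E < J.2)%E) => [sJ|_].
  by rewrite (le_lt_trans _ sJ) ?lee_fin.
by rewrite andbF.
Qed.

End Bars.

Section Betti.
Variables (d : nat) (a : 'I_d -> nat).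

(* The rank of the map [H_k X -> H_k Y], for [X] contained in [Y]. *)
Definition betti (k : int) (X Y : {set cube a}) : nat :=
  (\dim (cycles X k) - \dim (cycles X k :&: boundaries Y k))%N.

(** The only use made of the decomposition into interval modules: ranks add up over sums and are
    preserved by isomorphisms. From here on, diagrams are handled through these counts. *)
Lemma count_dgm (R : realType) (f : cube a -> R) D k r s : is_dgm f D -> r <= s ->
  count (fun x : lbar R => [&& x.1 == k, x.2.1 <= r & (s%:E < x.2.2)%E]) D
    = betti k (sublevel f r) (sublevel f s).
Proof.
move=> [_ /(_ k)[phi [phib phiE]]] rs.
pose M := pmodule_sum [seq bar_module x.2 | x <- D & x.1 == k].
apply: (has_rank_uniq (f := Defs.pmap M rs)).
  have := has_rank_bars [seq x.2 | x : lbar R <- D & x.1 == k] rs.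
  rewrite -map_comp count_map count_filter.
  by congr has_rank; apply: eq_count => x /=; rewrite andbC.
apply: (has_rank_iso (phib r) (bij_inj (phib s)) (phiE _ _ rs)).
exact: has_rank_quotv.
Qed.

End Betti.

(** * Elementary intervals and cubes *)

Section SpanRank.
Import VectorInternalTheory.

Lemma dim_span_mx (F : fieldType) (vT : vectType F) m n (e : m.-tuple vT)
    (X : n.-tuple vT) (A : 'M_(n, m)) :
  free e -> (forall i : 'I_n, X`_i = \sum_j A i j *: e`_j) -> \dim <<X>> = \rank A.
Proof.
have span_mx k (Y : k.-tuple vT) : <<Y>>%VS = mx2vs (b2mx Y).
  by rewrite [span]unlock tvalK; case: _ / (esym _).
have rowE k (Y : k.-tuple vT) i : row i (b2mx Y) = v2r Y`_i.
  by rewrite -tnth_nth rowK.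
rewrite /free {1}/dimv !span_mx /dimv /= !mxrank_gen size_tuple => eF XE.
rewrite -(mxrankMfree A eF); congr (\rank _); apply/row_matrixP => i.
rewrite rowE XE row_mul mulmx_sum_row linear_sum; apply: eq_bigr => j _.
by rewrite linearZ /= rowE mxE.
Qed.

End SpanRank.

Lemma F2_addrr (x : 'F_2) : x + x = 0.
Proof. by apply/val_inj; case: x => [[|[|m]] //= ?]. Qed.

Section Intervals.
Variable a : nat.
Implicit Types x y : eitv a.

Definition eitv_face x y : bool :=
  (eitv_left y <= eitv_left x)%N && (eitv_right x <= eitv_right y)%N.

Lemma eitv_dimE x : eitv_right x = (eitv_left x + eitv_dim x)%N.
Proof. by []. Qed.

Lemma eitv_dim_le1 x : (eitv_dim x <= 1)%N.
Proof. by rewrite /eitv_dim; case: (val x).2. Qed.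

Lemma eitv_right_le x : (eitv_right x <= a)%N.
Proof. exact: (valP x). Qed.

Lemma eitv_inj x y : eitv_left x = eitv_left y -> eitv_dim x = eitv_dim y -> x = y.
Proof.
rewrite /eitv_left /eitv_dim => lxy dxy; apply/val_inj.
case: (val x) (val y) lxy dxy => [l b] [l' b'] /= /val_inj ->.
by case: b; case: b'.
Qed.

Lemma eitv_ex l b : (l + b <= a)%N -> (b <= 1)%N ->
  exists2 x : eitv a, eitv_left x = l & eitv_dim x = b.
Proof.
move=> lb b1; have la : (l < a.+1)%N by lia.
have lb' : (Ordinal la + (b == 1) <= a)%N by move: lb b1 => /=; case: b => [|[]].
by exists (Sub (Ordinal la, b == 1) lb'); rewrite /eitv_left /eitv_dim SubK //=;
  move: b1; case: (b) => [|[]].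
Qed.

Lemma eitv_face_dim x y : eitv_face x y -> (eitv_dim x <= eitv_dim y)%N.
Proof. by rewrite /eitv_face !eitv_dimE; lia. Qed.

Lemma eitv_face_eq x y : eitv_face x y -> (eitv_dim y <= eitv_dim x)%N -> x = y.
Proof.
by rewrite /eitv_face !eitv_dimE => xy yx; apply: eitv_inj; lia.
Qed.

Lemma eitv_face_refl x : eitv_face x x.
Proof. by rewrite /eitv_face !leqnn. Qed.

Lemma eitv_face_trans : transitive eitv_face.
Proof. by rewrite /eitv_face => y x z; lia. Qed.

End Intervals.

Section Chains.
Variables (d : nat) (a : 'I_d -> nat).
Local Notation T := (cube a).
Local Notation F2 := ('F_2).
Implicit Types (s t u : T) (P Q : {set T}).

Lemma cube_faceP t s : reflect (forall i, eitv_face (t i) (s i)) (cube_face t s).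
Proof. exact: forallP. Qed.

Lemma cube_face_trans : transitive (@cube_face d a).
Proof.
move=> u t s /cube_faceP tu /cube_faceP us; apply/cube_faceP => i.
exact: eitv_face_trans (tu i) (us i).
Qed.

(** No coordinate loses dimension from [t] to [s] and the total grows by one, so a single coordinate
    passes from an end point to an edge. *)
Lemma cube_facetP t s : cube_facet t s -> exists j,
  [/\ eitv_face (t j) (s j), eitv_dim (t j) = 0%N, eitv_dim (s j) = 1%N
    & forall i, i != j -> t i = s i].
Proof.
case/andP=> /cube_faceP ts /eqP dts.
have dle i := eitv_face_dim (ts i).
have [j dj] : exists j, (eitv_dim (t j) < eitv_dim (s j))%N.
  apply/existsP; apply: contraPT dts => /existsPn H; apply/eqP.
  rewrite neq_ltn ltnS; apply/orP; left; apply: leq_sum => i _.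
  by rewrite leqNgt H.
exists j; split=> // [||i ij]; try by have := eitv_dim_le1 (s j); lia.
apply: eitv_face_eq => //; rewrite leqNgt; apply/negP => di.
move: dts; rewrite /cube_dim (bigD1 j) //= (bigD1 i) //= [in RHS](bigD1 j) //=.
rewrite [X in (_ + X).+1](bigD1 i) //=.
set x := (X in (_ + (_ + X))%N = _); set y := (X in _ = (_ + (_ + X))%N.+1).
have yx : (y <= x)%N by apply: leq_sum.
by move: x y yx dj di => x y; lia.
Qed.

Section Between.
Variables t u : T.

Let between s := cube_facet t s && cube_facet s u.
(* In a face poset of cubes, every interval of length two is a square; [opp]
   swaps its two middle cells. *)
Let opp s : T := [ffun i => if s i == t i then u i else t i].

Let betweenE s : between s -> forall i, s i = t i \/ s i = u i.
Proof.
case/andP=> /andP[/cube_faceP ts _] /andP[/cube_faceP su _] i.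
have := eitv_face_dim (ts i); have := eitv_face_dim (su i).
have := eitv_dim_le1 (u i) => u1 su1 ts1.
have [?|?] : (eitv_dim (s i) <= eitv_dim (t i))%N \/
             (eitv_dim (u i) <= eitv_dim (s i))%N by lia.
  by left; rewrite (eitv_face_eq (ts i)).
by right; rewrite (eitv_face_eq (su i)).
Qed.

Let oppK s : between s -> opp (opp s) = s.
Proof.
move=> bs; apply/ffunP => i; rewrite !ffunE.
by case: (betweenE bs i) => ->; case: (eqVneq (u i) (t i)) => [->|/negPf E];
  rewrite ?if_same ?(eqxx, E) ?if_same.
Qed.

Let between_opp s : between s -> between (opp s).
Proof.
move=> bs; have := betweenE bs.
case/andP: bs => /andP[ts dt] /andP[su du] stu.
have tu := cube_face_trans ts su.
(* In each coordinate, [opp s] and [s] together take the values [t i] and [u i]. *)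
have dim_opp : (cube_dim (opp s) + cube_dim s = cube_dim t + cube_dim u)%N.
  rewrite -!big_split /=; apply: eq_bigr => i _; rewrite ffunE.
  by case: eqP => [->|]; [lia | case: (stu i) => -> // _; lia].
move/cube_faceP in tu; rewrite /between /cube_facet.
have -> : cube_face t (opp s).
  by apply/cube_faceP => i; rewrite ffunE; case: ifP => _; rewrite ?tu ?eitv_face_refl.
have -> : cube_face (opp s) u.
  by apply/cube_faceP => i; rewrite ffunE; case: ifP => _; rewrite ?tu ?eitv_face_refl.
by move: (cube_dim _) dim_opp dt du => n; lia.
Qed.

Lemma sum_between (x : F2) : \sum_(s | cube_facet t s && cube_facet s u) x = 0.
Proof.
rewrite -/between; case: (pickP between) => [s0 bs0|none]; last first.
  by rewrite big_pred0.
have [i tui] : exists i, t i != u i.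
  apply/existsP; apply: contraTT bs0 => /existsPn tu.
  have E : t = u by apply/ffunP => i; apply/eqP/negbNE/tu.
  rewrite /between /cube_facet E; apply/negP => /andP[/andP[_ /eqP->]] /andP[_].
  by rewrite eqn_leq ltnNge leqnSn andbF.
(* The middle cells agree at [i] either with [t] or with [u]; [opp] exchanges the two halves, whose
   equal sums cancel modulo 2. *)
rewrite (bigID (fun s => s i == t i)) /=.
rewrite [X in _ + X](reindex_onto opp opp) /=; last by move=> s /andP[/oppK].
rewrite [X in _ + X](eq_bigl (fun s => between s && (s i == t i))).
  by rewrite -big_split /= big1 // => s _; exact: F2_addrr.
move=> s; apply/andP/andP => [[/andP[bos osi] /eqP ooE]|[bs si]].
  have bs : between s by rewrite -ooE; apply: between_opp.
  by split=> //; move: osi; rewrite ffunE; case: ifP => //; rewrite eqxx.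
split; last by rewrite oppK.
by apply/andP; split; [exact: between_opp | rewrite ffunE si eq_sym tui].
Qed.

End Between.

Lemma bd_bd (c : chain a) : bd (bd c) = 0.
Proof.
apply/ffunP => t; rewrite !ffunE.
under eq_bigr do rewrite ffunE.
rewrite (exchange_big_dep predT) //=; apply: big1 => u _.
exact: sum_between.
Qed.

End Chains.

(** * Ranks of blocks of the incidence matrix *)

Section Incidence.
Variables (d : nat) (a : 'I_d -> nat).
Local Notation T := (cube a).
Implicit Types (s t u : T) (P Q X Y : {set T}) (c : chain a) (k : int).

Definition cells X k : {set T} := [set s in X | (cube_dim s)%:Z == k].

Definition cspan Q : {vspace chain a} := <<[seq cube_chain s | s <- enum Q]>>%VS.

Lemma chainsE X k : chains X k = cspan (cells X k).
Proof.
apply/eq_span/eq_mem_map => s.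
by rewrite mem_filter !mem_enum inE andbC.
Qed.

Lemma scale_cube_chain (k : 'F_2) s :
  k *: cube_chain s = [ffun t => if t == s then k else 0] :> chain a.
Proof.
apply/ffunP => t; rewrite ffunE !ffunE; case: eqP => _; [exact: mulr1 | exact: mulr0].
Qed.

Lemma chain_sum c : c = \sum_s c s *: cube_chain s.
Proof.
apply/ffunP => t; rewrite sum_ffunE (bigD1 t isT) /=.
rewrite scale_cube_chain ffunE eqxx big1 ?addr0 // => s /= st.
by rewrite scale_cube_chain ffunE eq_sym (negPf st).
Qed.

Lemma memv_cube_chain Q s : s \in Q -> cube_chain s \in cspan Q.
Proof. by move=> sQ; apply/memv_span/map_f; rewrite mem_enum. Qed.

Definition mask P c : chain a := [ffun s => if s \in P then c s else 0].

Fact mask_linear P : linear (mask P).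
Proof.
move=> b c c'; apply/ffunP => s; rewrite !ffunE.
by case: ifP => _; rewrite ?scaler0 ?addr0.
Qed.
HB.instance Definition _ P :=
  GRing.isLinear.Build 'F_2 (chain a) (chain a) _ (mask P) (mask_linear P).

Lemma mem_cspan Q c : (c \in cspan Q) = [forall s, (c s != 0) ==> (s \in Q)].
Proof.
apply/idP/forallP => [cQ s|cQ].
  apply/implyP; apply: contraNT => sQ.
  have /subvP/(_ _ cQ) : (cspan Q <= lker (linfun (mask (~: Q))))%VS.
    apply/span_subvP => y /mapP[t]; rewrite mem_enum => tQ ->.
    rewrite memv_ker lfunE /=; apply/eqP/ffunP => u; rewrite !ffunE inE.
    by case: ifP => //; case: eqP => // ->; rewrite tQ.
  by rewrite memv_ker lfunE /= => /eqP/ffunP/(_ s); rewrite !ffunE inE sQ => ->.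
rewrite [c]chain_sum; apply: memv_suml => s _.
have /implyP := cQ s; case: (c s =P 0) => [-> _|_ sQ]; first by rewrite scale0r mem0v.
by rewrite memvZ // memv_cube_chain // sQ.
Qed.

Lemma cspanP Q c : reflect (forall s, s \notin Q -> c s = 0) (c \in cspan Q).
Proof.
rewrite mem_cspan; apply: (iffP forallP) => H s.
  by move=> sQ; apply/eqP; move: (H s); apply: contraTT => cs; rewrite cs (negPf sQ).
by apply/implyP; apply: contraNT => /H ->.
Qed.

Lemma lker_mask P : lker (linfun (mask P)) = cspan (~: P).
Proof.
apply/vspaceP => c; rewrite memv_ker lfunE /=; apply/eqP/cspanP => [/ffunP H s|H].
  by rewrite inE negbK => sP; have := H s; rewrite !ffunE sP.
by apply/ffunP => s; rewrite !ffunE; case: ifP => // sP; apply: H; rewrite inE sP.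
Qed.

Lemma cspan_setT : cspan setT = fullv.
Proof. by apply/vspaceP => c; rewrite memvf; apply/cspanP => s; rewrite inE. Qed.

Lemma limg_mask P : limg (linfun (mask P)) = cspan P.
Proof.
apply/vspaceP => c; apply/memv_imgP/cspanP => [[u _ ->] s sP|H].
  by rewrite lfunE /= ffunE (negPf sP).
exists c; rewrite ?memvf // lfunE /=; apply/ffunP => s; rewrite ffunE.
by case: ifPn => // /H.
Qed.

Let e := map_tuple (@cube_chain d a) (enum_tuple {: T}).

Let eE (i : 'I_#|{: T}|) : e`_i = cube_chain (enum_val i).
Proof.
have ii : (i < size (enum {: T}))%N by rewrite -cardE; apply: ltn_ord.
rewrite /= (nth_map (enum_val i) _ _ ii); congr cube_chain.
exact/esym/enum_val_nth.
Qed.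

Let e_free : free e.
Proof.
apply/freeP => k; rewrite (eq_bigr (fun i => k i *: cube_chain (enum_val i))) => [|i _].
  move=> H i; have /ffunP/(_ (enum_val i)) := H; rewrite sum_ffunE (bigD1 i isT) /=.
  rewrite scale_cube_chain ffunE eqxx big1 ?addr0 => [->|j /= ji]; first by rewrite ffunE.
  by rewrite scale_cube_chain ffunE (inj_eq enum_val_inj) eq_sym (negPf ji).
by rewrite eE.
Qed.

Lemma dim_cspan Q : \dim (cspan Q) = #|Q|.
Proof.
suff /eqP -> : free [seq cube_chain s | s <- enum Q] by rewrite size_map -cardE.
have -> : [seq cube_chain s | s <- enum Q] =
    [seq c <- e | c \in [seq cube_chain s | s <- enum Q]].
  rewrite /= filter_map; congr map; rewrite enumT {1}/enum_mem.
  apply: eq_filter => s /=; rewrite mem_map ?mem_enum // => t u /ffunP/(_ t).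
  by rewrite !ffunE eqxx; case: eqP.
exact: filter_free e_free.
Qed.

(** The block sits in a matrix over all cubes, with zero rows and columns elsewhere, so that its
    type does not depend on [P] and [Q]. *)
Definition incidence P Q : 'M['F_2]_#|{: T}| :=
  \matrix_(i, j) [&& enum_val i \in P, enum_val j \in Q &
                     cube_facet (enum_val i) (enum_val j)]%:R.

Definition irank P Q : nat := \rank (incidence P Q).

Lemma dim_mask_bd P Q :
  \dim (linfun (mask P) @: (linfun (@bd d a) @: cspan Q)) = irank P Q.
Proof.
(* With [cspan Q] written as the image of all chains under [mask Q], the space is spanned by an
   explicit tuple whose coordinate matrix is the transposed block. *)
rewrite /irank -mxrank_tr -limg_mask -cspan_setT /cspan.
have -> : enum [set: T] = enum {: T} by apply: eq_enum => s; rewrite inE.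
rewrite !limg_span.
apply: (@dim_span_mx _ _ _ _ e (map_tuple _ (map_tuple _ (map_tuple _ e)))) => //.
move=> i; under eq_bigr do rewrite eE.
have ii : (i < size (enum {: T}))%N by rewrite -cardE; apply: ltn_ord.
have ie : (i < size (tval e))%N by rewrite size_map.
transitivity (linfun (mask P) (linfun (@bd d a) (linfun (mask Q) (cube_chain (enum_val i))))).
  have i3 := ie.
  have i2 : (i < size (map (linfun (mask Q)) e))%N by rewrite size_map.
  have i1 : (i < size (map (linfun (@bd d a)) (map (linfun (mask Q)) e)))%N.
    by rewrite size_map.
  by rewrite -(eE i) (nth_map 0 _ _ i1) (nth_map 0 _ _ i2) (nth_map 0 _ _ i3).
rewrite !lfunE /=.
rewrite [LHS]chain_sum (reindex (@enum_val T predT)) /=; last exact/onW_bij/enum_val_bij.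
apply: eq_bigr => j _; congr (_ *: _); rewrite !mxE !ffunE.
case: ifP => // _; case: (boolP (cube_facet (enum_val j) (enum_val i))) => [f|nf].
  rewrite (bigD1 (enum_val i)) //= !ffunE eqxx big1 ?addr0 ?andbT; last first.
    by move=> s /andP[_ si]; rewrite !ffunE (negPf si) if_same.
  by case: ifP.
rewrite andbF big1 // => s fs; rewrite !ffunE; case: eqP fs => [->|_ _].
  by rewrite (negPf nf).
by rewrite if_same.
Qed.

Lemma dim_bd Q : \dim (linfun (@bd d a) @: cspan Q) = irank setT Q.
Proof.
rewrite -dim_mask_bd [RHS]limg_dim_eq // lker_mask setCT.
suff -> : cspan set0 = 0%VS by rewrite capv0.
by apply/eqP; rewrite -dimv_eq0 dim_cspan cards0.
Qed.

Lemma dim_ker_bd Q :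
  (\dim (cspan Q :&: lker (linfun (@bd d a))) + irank setT Q)%N = #|Q|.
Proof. by rewrite -dim_bd limg_ker_dim dim_cspan. Qed.

Lemma dim_bd_cap P Q :
  (\dim (linfun (@bd d a) @: cspan Q :&: cspan P) + irank (~: P) Q)%N = irank setT Q.
Proof. by rewrite -dim_mask_bd -[P in LHS]setCK -lker_mask setCK limg_ker_dim dim_bd. Qed.

Lemma boundariesE Y k : boundaries Y k = (linfun (@bd d a) @: cspan (cells Y (k + 1)))%VS.
Proof. by rewrite /boundaries chainsE. Qed.

Lemma boundaries_ker Y k : (boundaries Y k <= lker (linfun (@bd d a)))%VS.
Proof.
apply/subvP => _ /memv_imgP[c _ ->].
by rewrite memv_ker !lfunE /= bd_bd.
Qed.

(** Rank-nullity for both terms of [betti], with sums on either side because subtraction on [nat]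
    truncates. *)
Lemma betti_irank k X Y :
  (betti k X Y + irank setT (cells X k) + irank setT (cells Y (k + 1)))%N =
  (#|cells X k| + irank (~: cells X k) (cells Y (k + 1)))%N.
Proof.
rewrite /betti; have := dimvS (capvSl (cycles X k) (boundaries Y k)).
(* Boundaries are cycles, so for a boundary, being a cycle of [X] only means being supported on
   [X]. *)
have -> : (cycles X k :&: boundaries Y k = boundaries Y k :&: cspan (cells X k))%VS.
  apply/vspaceP => c; rewrite /cycles chainsE !memv_cap.
  case: (boolP (c \in boundaries Y k)) => [/(subvP (boundaries_ker _ _)) ->|].
    by rewrite !andbT.
  by rewrite andbF.
rewrite boundariesE /cycles chainsE.
have arith (z b i j m n : nat) : (b + m = j -> z + i = n -> b <= z ->
  z - b + i + j = n + m)%N by lia.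
by apply: arith; [apply: dim_bd_cap | apply: dim_ker_bd].
Qed.

End Incidence.

(* Duality enters here: an incidence-reversing bijection transposes blocks of
   the incidence matrix. *)
Lemma irank_tr (d d' : nat) (a : 'I_d -> nat) (b : 'I_d' -> nat)
    (f : cube a -> cube b) (P Q : {set cube a}) (P' Q' : {set cube b}) :
  injective f ->
  (forall t s, [&& t \in P, s \in Q & cube_facet t s] =
    [&& f s \in P', f t \in Q' & cube_facet (f s) (f t)]) ->
  (forall t s, t \in P' -> s \in Q' -> cube_facet t s ->
    t \in codom f /\ s \in codom f) ->
  irank P' Q' = irank P Q.
Proof.
move=> fI fE fim.
(* The 0-1 matrix of [f]. It need not be invertible, as [f] is only injective; each block is instead
   factored through the transpose of the other, which gives both inequalities. *)
pose E : 'M['F_2]_(#|{: cube a}|, #|{: cube b}|) :=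
  \matrix_(i, j) (f (enum_val i) == enum_val j)%:R.
have Eq1 : incidence P Q = E *m (incidence P' Q')^T *m E^T.
  apply/matrixP => i j; rewrite !mxE (bigD1 (enum_rank (f (enum_val j)))) //= !mxE.
  rewrite enum_rankK eqxx mulr1 (bigD1 (enum_rank (f (enum_val i)))) //= !mxE.
  rewrite enum_rankK eqxx mul1r enum_rankK fE.
  rewrite !big1 ?addr0 //= => k; rewrite -(inj_eq enum_val_inj) enum_rankK eq_sym !mxE.
    by move/negPf->; rewrite mulr0.
  by move/negPf->; rewrite mul0r.
(* By [fim], the nonzero entries of the block of [P'] and [Q'] all sit at images of [f], so nothing
   is lost in passing through [E]. *)
have Eq2 : (incidence P' Q')^T = E^T *m incidence P Q *m E.
  apply/matrixP => i j; rewrite !mxE.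
  case: (boolP [&& enum_val j \in P', enum_val i \in Q' &
         cube_facet (enum_val j) (enum_val i)]) => [H|nH].
    have /and3P[jP iQ ji] := H; have [/codomP[s js] /codomP[t it]] := fim _ _ jP iQ ji.
    rewrite (bigD1 (enum_rank s)) //= !mxE enum_rankK -js eqxx mulr1.
    rewrite (bigD1 (enum_rank t)) //= !mxE !enum_rankK -it eqxx mul1r.
    rewrite fE -js -it H !big1 ?addr0 // => k; rewrite -(inj_eq enum_val_inj) enum_rankK !mxE.
      by move=> /negPf kt; rewrite js (inj_eq fI) kt mulr0.
    by move=> /negPf kt; rewrite it (inj_eq fI) kt mul0r.
  apply/esym/big1 => k _; rewrite !mxE; case: eqP => [kj|]; last by rewrite mulr0.
  rewrite mulr1; apply: big1 => l _; rewrite !mxE; case: eqP => [li|]; last by rewrite mul0r.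
  by rewrite mul1r fE kj li (negPf nH).
rewrite /irank; apply/eqP; rewrite eqn_leq; apply/andP; split.
  rewrite -mxrank_tr Eq2 (leq_trans (mxrankM_maxl _ _)) //.
  exact: mxrankM_maxr.
rewrite {1}Eq1 -[X in (_ <= X)%N]mxrank_tr (leq_trans (mxrankM_maxl _ _)) //.
exact: mxrankM_maxr.
Qed.

(** * Boxes are acyclic *)

Section IntervalCodes.
Variable a : nat.
Implicit Types x y : eitv a.

Definition eitv_of x l b : eitv a :=
  odflt x [pick y | (eitv_left y == l) && (eitv_dim y == b)].

Lemma eitv_ofP x l b : (l + b <= a)%N -> (b <= 1)%N ->
  eitv_left (eitv_of x l b) = l /\ eitv_dim (eitv_of x l b) = b.
Proof.
move=> lb b1; rewrite /eitv_of; case: pickP => [y /andP[/eqP ? /eqP ?] //|].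
have [y yl yb] := eitv_ex lb b1.
by move/(_ y); rewrite yl yb !eqxx.
Qed.

(** Numbers the cells of [0, a] from left to right: points are even, edges odd, and incident cells
    consecutive. *)
Definition eitv_code x : nat := ((eitv_left x).*2 + eitv_dim x)%N.

Lemma eitv_code_inj : injective eitv_code.
Proof.
move=> x y; rewrite /eitv_code => xy.
have := eitv_dim_le1 x; have := eitv_dim_le1 y => ? ?.
by apply: eitv_inj; lia.
Qed.

Lemma eitv_facet_code x y : eitv_face x y -> eitv_dim x = 0%N -> eitv_dim y = 1%N ->
  eitv_code x = (eitv_code y).+1 \/ eitv_code y = (eitv_code x).+1.
Proof. by rewrite /eitv_face /eitv_code !eitv_dimE => + x0 y1; rewrite x0 y1; lia. Qed.

(** On codes this exchanges 2l + 1 with 2l + 2 and fixes 0: a matching of the segment that leaves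
    only its left end unpaired. *)
Definition eitv_flip x : eitv a :=
  if eitv_dim x == 1%N then eitv_of x (eitv_left x).+1 0
  else if eitv_left x == 0%N then x else eitv_of x (eitv_left x).-1 1.

Lemma eitv_flip_code x : eitv_code (eitv_flip x) =
  if eitv_dim x == 1%N then (eitv_code x).+1 else (eitv_code x).-1.
Proof.
rewrite /eitv_flip /eitv_code; have := eitv_dim_le1 x; have := eitv_right_le x.
rewrite eitv_dimE => xa x1; case: eqP => [xe|xe].
  by have [|//|-> ->] := @eitv_ofP x (eitv_left x).+1 0; lia.
case: eqP => [x0|x0]; first by lia.
by have [|//|-> ->] := @eitv_ofP x (eitv_left x).-1 1; lia.
Qed.

Lemma eitv_code_dim x : eitv_dim x = odd (eitv_code x).
Proof.
rewrite /eitv_code oddD odd_double /=.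
by have := eitv_dim_le1 x; case: (eitv_dim x) => [|[]].
Qed.

Lemma eitv_flipK : involutive eitv_flip.
Proof.
move=> x; apply: eitv_code_inj; rewrite !(eitv_flip_code, eitv_code_dim).
by case: (eitv_code x) => [|c] //=; case E: (odd c); rewrite //= E.
Qed.

Lemma eitv_flip_code0 x : (eitv_code (eitv_flip x) == 0%N) = (eitv_code x == 0%N).
Proof.
rewrite eitv_flip_code eitv_code_dim; case: (eitv_code x) => [|[|c]] //=.
by case: (odd c).
Qed.

Lemma eitv_flip0 x : eitv_code x = 0%N -> eitv_flip x = x.
Proof.
by move=> x0; apply: eitv_code_inj; rewrite eitv_flip_code eitv_code_dim x0.
Qed.

Lemma eitv_flip_dim x : eitv_code x != 0%N ->
  (eitv_dim (eitv_flip x) + eitv_dim x = 1)%N.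
Proof.
rewrite !eitv_code_dim eitv_flip_code eitv_code_dim; case: (eitv_code x) => [|c] //= _.
by case E: (odd c); rewrite //= E.
Qed.

Lemma eitv_flip_face x : eitv_dim x = 1%N -> eitv_face (eitv_flip x) x.
Proof.
move=> x1; rewrite /eitv_flip x1 eqxx /eitv_face !eitv_dimE x1.
have := eitv_right_le x; rewrite eitv_dimE x1 => xa.
by have [|//|-> ->] := @eitv_ofP x (eitv_left x).+1 0; lia.
Qed.

End IntervalCodes.

Section Box.
Variables (d : nat) (a : 'I_d -> nat).
Local Notation T := (cube a).
Implicit Types (s t u w : T) (P Q X Y : {set T}) (c : chain a) (k : int).

Lemma cube_dim_off (s t : T) j : (forall i, i != j -> t i = s i) ->
  (cube_dim s + eitv_dim (t j) = cube_dim t + eitv_dim (s j))%N.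
Proof.
move=> E; rewrite /cube_dim !(bigD1 j isT) /=.
rewrite (eq_bigr (fun i => eitv_dim (s i)) (F1 := fun i => eitv_dim (t i))) => [|i /E ->] //.
by rewrite addnAC [RHS]addnAC [X in (X + _)%N]addnC.
Qed.

Lemma cube_facetI t s j : eitv_face (t j) (s j) -> eitv_dim (t j) = 0%N ->
  eitv_dim (s j) = 1%N -> (forall i, i != j -> t i = s i) -> cube_facet t s.
Proof.
move=> tsj t0 s1 E; have := cube_dim_off E; rewrite t0 s1 addn0 addn1 => /eqP dE.
rewrite /cube_facet dE andbT; apply/cube_faceP => i.
by have [->//|/E ->] := eqVneq i j; apply: eitv_face_refl.
Qed.

(* The pairing of an acyclic matching whose only critical cell is the origin:
   in the first coordinate where a cell differs from [0], exchange the edge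
   [l, l + 1] and the point [l + 1]. *)
Definition cube_flip s : T :=
  [ffun i : 'I_d => if [forall j : 'I_d, (j < i)%N ==> (eitv_code (s j) == 0%N)]
             then eitv_flip (s i) else s i].

Lemma cube_flip_code0 s i :
  (eitv_code (cube_flip s i) == 0%N) = (eitv_code (s i) == 0%N).
Proof. by rewrite ffunE; case: ifP => _; rewrite ?eitv_flip_code0. Qed.

Lemma cube_flipK : involutive cube_flip.
Proof.
move=> s; apply/ffunP => i; rewrite ffunE.
rewrite (eq_forallb (P2 := fun j : 'I_d => (j < i)%N ==> (eitv_code (s j) == 0%N))).
  by rewrite ffunE; case: [forall j, _]; rewrite ?eitv_flipK.
by move=> j; rewrite cube_flip_code0.
Qed.

Definition origin s : bool := [forall i, eitv_code (s i) == 0%N].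

Lemma origin_flip s : origin s -> cube_flip s = s.
Proof.
move=> /forallP s0; apply/ffunP => i; rewrite ffunE.
by rewrite eitv_flip0 ?if_same //; apply/eqP.
Qed.

(** [cube_flip] also flips the zero coordinates before the leading one, but [eitv_flip] fixes these,
    so only the leading coordinate moves. *)
Lemma cube_lead s : ~~ origin s -> exists i,
  [/\ eitv_code (s i) != 0%N, forall j : 'I_d, (j < i)%N -> eitv_code (s j) = 0%N,
      cube_flip s i = eitv_flip (s i) & forall j, j != i -> cube_flip s j = s j].
Proof.
move=> /forallPn[i0 s0].
case: (@arg_minnP _ i0 (fun i => eitv_code (s i) != 0%N) val s0) => i si imin; exists i.
have low (j : 'I_d) : (j < i)%N -> eitv_code (s j) = 0%N.
  by move=> ji; apply/eqP; apply: contraLR ji => /imin; rewrite -leqNgt.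
split=> // [|j ji]; rewrite ffunE.
  by rewrite (_ : [forall j, _]) //; apply/forallP => j; apply/implyP => /low ->.
case: forallP => // H; rewrite eitv_flip0 //.
case: (ltngtP j i) => [/low //|ij|/val_inj ji']; last by rewrite ji' eqxx in ji.
by have /implyP/(_ ij) := H i; rewrite (negPf si).
Qed.

Definition matched_down : {set T} := [set s | cube_dim s == (cube_dim (cube_flip s)).+1].
Definition matched_up : {set T} := [set s | cube_dim (cube_flip s) == (cube_dim s).+1].

Lemma cube_flip_dim s : ~~ origin s -> (s \in matched_down) = (s \notin matched_up).
Proof.
move=> /cube_lead[i [si _ fi fj]]; rewrite !inE.
have := cube_dim_off fj; have := eitv_flip_dim si; rewrite fi.
by move: (cube_dim s) (cube_dim _) => m n; lia.
Qed.

Lemma origin_code s t : origin s -> origin t -> s = t.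
Proof.
move=> /forallP s0 /forallP t0; apply/ffunP => i; apply: eitv_code_inj.
by rewrite (eqP (s0 i)) (eqP (t0 i)).
Qed.

Lemma origin_dim s : origin s -> cube_dim s = 0%N.
Proof.
move=> /forallP s0; apply: big1 => i _.
by rewrite eitv_code_dim (eqP (s0 i)).
Qed.

(* The weights decrease, so that among the facets of [w] in [matched_down] the
   partner [cube_flip w] is the highest one: moving the leading coordinate up
   outweighs any move of a later coordinate. *)
Definition height s : nat := (\sum_(i < d) eitv_code (s i) * (d - i))%N.

Lemma height_off (s t : T) j : (forall i, i != j -> t i = s i) ->
  (height s + eitv_code (t j) * (d - j) = height t + eitv_code (s j) * (d - j))%N.
Proof.
move=> E; rewrite /height !(bigD1 j isT) /=.
have -> : (\sum_(i < d | i != j) eitv_code (t i) * (d - i) =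
           \sum_(i < d | i != j) eitv_code (s i) * (d - i))%N.
  by apply: eq_bigr => i /E ->.
by rewrite addnAC [RHS]addnAC [X in (X + _)%N]addnC.
Qed.

Lemma matched_down_lead s : s \in matched_down -> exists i,
  [/\ eitv_dim (s i) = 1%N, forall j : 'I_d, (j < i)%N -> eitv_code (s j) = 0%N,
      cube_flip s i = eitv_flip (s i) & forall j, j != i -> cube_flip s j = s j].
Proof.
rewrite inE => sD; have : ~~ origin s.
  by apply: contraL sD => /origin_flip ->; rewrite ltn_eqF.
move=> /cube_lead[i [si low fi fj]]; exists i; split=> //.
have := cube_dim_off fj; have := eitv_flip_dim si; rewrite fi (eqP sD).
by move: (cube_dim _) => m; lia.
Qed.

Lemma cube_facet_flip w : w \in matched_down -> cube_facet (cube_flip w) w.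
Proof.
move=> /matched_down_lead[i [wi _ fi fj]]; apply: (cube_facetI (j := i)); rewrite ?fi //.
  exact: eitv_flip_face.
have := eitv_flip_dim (x := w i); rewrite wi => E.
suff : eitv_code (w i) != 0%N by move/E; lia.
by rewrite /eitv_code wi addn1.
Qed.

Lemma height_flip w s : w \in matched_down -> cube_facet s w -> s != cube_flip w ->
  (height s < height (cube_flip w))%N.
Proof.
move=> /matched_down_lead[i [wi low fi fj]] /cube_facetP[j [sj s0 w1 sE]] sw.
have := height_off fj; rewrite fi eitv_flip_code wi eqxx mulSn.
have := height_off sE; have := ltn_ord i; have := ltn_ord j.
(* A left end lies below [w], while the partner lies above it. A right end in coordinate [j] rises
   by [d - j] only, less than the [d - i] of the partner if [j > i]; for [j = i] it is the partner,
   and for [j < i] the coordinate of [w] is a point. *)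
have [sc|wc] := eitv_facet_code sj s0 w1; last first.
  rewrite wc mulSn; nia.
rewrite sc mulSn.
case: (ltngtP j i) => [/low wj|ij|/val_inj ji]; last 1 first.
- case/eqP: sw; apply/ffunP => l; have [->|lj] := eqVneq l j; last by rewrite sE // fj // -ji.
  by apply: eitv_code_inj; rewrite ji fi eitv_flip_code wi eqxx -ji sc.
- by move: w1; rewrite eitv_code_dim wj.
by nia.
Qed.

(** Triangularity: let [w] in the support of [c] have the highest partner. Another cell of the
    support with that partner as a facet would have a still higher partner, so the coefficient of
    [bd c] there is [c w]. *)
Lemma bd_matched_down c : c \in cspan matched_down -> bd c = 0 -> c = 0.
Proof.
move=> /cspanP cD bc; apply/eqP; apply: contraT => c0.
have [w0 w0c] : exists w, c w != 0.
  apply/existsP; apply: contraNT c0 => /existsPn H.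
  by apply/eqP/ffunP => w; rewrite ffunE; apply/eqP/negbNE/H.
case: (@arg_maxnP _ w0 (fun w => c w != 0) (fun w => height (cube_flip w)) w0c) => w cw wmax.
have wD : w \in matched_down by apply: contraNT cw => /cD ->.
case/negP: cw; have /ffunP/(_ (cube_flip w)) := bc; rewrite !ffunE.
rewrite (bigD1 w) /=; last exact: cube_facet_flip.
rewrite big1 ?addr0 => [->//|u /andP[fu uw]].
apply/eqP; apply: contraT => cu; have := wmax u cu.
rewrite /= leqNgt height_flip //; first by apply: contraNT cu => /cD ->.
by rewrite (inj_eq (inv_inj cube_flipK)) eq_sym.
Qed.

Lemma irank_monor P Q Q' : Q \subset Q' -> (irank P Q <= irank P Q')%N.
Proof.
move=> QQ'; rewrite -!dim_mask_bd; apply/dimvS/limgS/limgS/sub_span => c.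
case/mapP => s; rewrite mem_enum => sQ ->; apply: map_f.
by rewrite mem_enum (subsetP QQ').
Qed.

Lemma irank_matched_down k :
  (#|cells matched_down k| <= irank [set: T] (cells setT k))%N.
Proof.
apply: leq_trans (irank_monor _ (_ : cells matched_down k \subset _)); last first.
  by apply/subsetP => s; rewrite !inE => /andP[].
rewrite -dim_bd limg_dim_eq ?dim_cspan //.
apply/eqP; rewrite -subv0; apply/subvP => c; rewrite memv_cap memv_ker lfunE /=.
case/andP=> /cspanP cD /eqP bc; rewrite memv0; apply/eqP/bd_matched_down => //.
by apply/cspanP => s sD; apply: cD; apply: contraNN sD; rewrite !inE => /andP[].
Qed.

Lemma card_matched_up k : #|cells matched_up k| = #|cells matched_down (k + 1)|.
Proof.
rewrite -(card_imset _ (inv_inj cube_flipK)); apply: eq_card => s.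
rewrite (can2_imset_pre _ cube_flipK cube_flipK) !inE cube_flipK.
by case: eqP => //= ->; rewrite -[in RHS]addn1 PoszD (inj_eq (addIr _)).
Qed.

Lemma ex_origin : exists s, origin s.
Proof.
have : forall i, exists x : eitv (a i), eitv_code x == 0%N.
  move=> i; have [x xl xd] := @eitv_ex (a i) 0 0 isT isT.
  by exists x; rewrite /eitv_code xl xd.
move=> ex; exists [ffun i => xchoose (ex i)].
by apply/forallP => i; rewrite ffunE; apply: (xchooseP (ex i)).
Qed.

Lemma card_cells k :
  #|cells [set: T] k| = (#|cells matched_down k| + #|cells matched_up k| + (k == 0))%N.
Proof.
have [o oo] := ex_origin.
have oE s : origin s = (s == o).
  by apply/idP/eqP => [so|-> //]; apply: origin_code.
have -> : cells setT k = cells matched_down k :|: cells matched_up k :|: cells [set o] k.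
  apply/setP => s; rewrite !inE; case: (cube_dim s == k :> int); rewrite ?andbF //= !andbT.
  have := oE s; case: eqP => [_ _|_ /negbT so]; first by rewrite orbT.
  by have := cube_flip_dim so; rewrite !inE orbF => ->; rewrite orNb.
rewrite cardsU cardsU.
have -> : cells matched_down k :&: cells matched_up k = set0.
  apply/setP => s; rewrite !inE; apply/negP => /andP[/andP[/eqP sD _] /andP[/eqP sU _]].
  by move: sU; rewrite sD => /eqP; rewrite -addn2 -[X in X == _]addn0 eqn_add2l.
have -> : (cells matched_down k :|: cells matched_up k) :&: cells [set o] k = set0.
  apply/setP => s; rewrite !inE; apply/negP => /andP[/orP H /andP[/eqP so _]].
  have of_ : cube_flip o = o by rewrite origin_flip.
  by case: H; rewrite so of_ => /andP[]; rewrite ltn_eqF.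
rewrite !cards0 !subn0; congr (_ + _)%N.
have [->|k0] := eqVneq k 0.
  rewrite (_ : cells [set o] 0 = [set o]) ?cards1 //.
  by apply/setP => s; rewrite !inE; case: eqP => // ->; rewrite origin_dim.
rewrite (_ : cells [set o] k = set0) ?cards0 //.
apply/setP => s; rewrite !inE; case: eqP => // ->; rewrite origin_dim //.
by rewrite eq_sym (negPf k0).
Qed.

Lemma dim_boundaries k : \dim (boundaries [set: T] k) = irank [set: T] (cells setT (k + 1)).
Proof. by rewrite boundariesE dim_bd. Qed.

Lemma dim_cycles k :
  (\dim (cycles [set: T] k) + irank [set: T] (cells setT k))%N = #|cells [set: T] k|.
Proof. by rewrite /cycles chainsE dim_ker_bd. Qed.

Lemma boundaries_cycles X k : (boundaries X k <= cycles [set: T] k)%VS.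
Proof.
rewrite subv_cap boundaries_ker andbT chainsE boundariesE.
apply/subvP => _ /memv_imgP[c /cspanP cX ->]; rewrite lfunE /=.
apply/cspanP => t tk; rewrite ffunE; apply: big1 => s /andP[_ /eqP st].
apply: cX; apply: contraNN tk; rewrite !inE => /andP[_].
by rewrite st -addn1 PoszD (inj_eq (addIr _)).
Qed.

(** The first inequality says that boundaries are cycles. For the second, the two ranks are at least
    the numbers of [k]-cells matched down and up, and only the origin is unmatched. *)
Lemma box_irank k :
  (irank [set: T] (cells setT k) + irank [set: T] (cells setT (k + 1)) <=
   #|cells [set: T] k| <=
   irank [set: T] (cells setT k) + irank [set: T] (cells setT (k + 1)) + (k == 0))%N.
Proof.
have := dimvS (boundaries_cycles setT k); rewrite dim_boundaries.
have := dim_cycles k; have := irank_matched_down k.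
have := irank_matched_down (k + 1); rewrite -card_matched_up.
have := card_cells k.
move: (irank _ _) (irank _ _) (\dim _) #|_| #|_| #|_| (nat_of_bool _).
by move=> *; lia.
Qed.

Lemma box_acyclic k : k != 0 -> cycles [set: T] k = boundaries [set: T] k.
Proof.
move=> /negPf k0; apply/esym/eqP; rewrite eqEdim boundaries_cycles dim_boundaries.
have := dim_cycles k; have := box_irank k; rewrite k0 addn0.
move: (irank _ _) (irank _ _) (\dim _) #|_|.
by move=> *; lia.
Qed.

(** The augmentation of 0-chains; the sum runs over all cells because [chain] collects all
    degrees. *)
Definition aug c : ('F_2)^o := \sum_s c s.

Fact aug_linear : linear aug.
Proof.
move=> x c c'; rewrite /aug scaler_sumr -big_split; apply: eq_bigr => s _.
by rewrite !ffunE.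
Qed.
HB.instance Definition _ :=
  GRing.isLinear.Build 'F_2 (chain a) ('F_2)^o _ aug aug_linear.

Lemma cube_edge s : cube_dim s = 1%N ->
  exists j, eitv_dim (s j) = 1%N /\ forall i, i != j -> eitv_dim (s i) = 0%N.
Proof.
move=> s1; have [j sj] : exists j, eitv_dim (s j) != 0%N.
  apply/existsP; apply: contra_eqT s1 => /existsPn s0.
  by rewrite /cube_dim big1 // => i _; apply/eqP/negbNE/s0.
have sj1 : eitv_dim (s j) = 1%N by have := eitv_dim_le1 (s j); lia.
exists j; split=> // i ij; move: s1; rewrite /cube_dim (bigD1 j) //= (bigD1 i) //= sj1.
by move: (bigop _ _ _) => n; lia.
Qed.

Lemma sum_endpoints s (x : 'F_2) : cube_dim s = 1%N -> \sum_(t | cube_facet t s) x = 0.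
Proof.
move=> s1; have [j [sj soff]] := cube_edge s1.
(* The two end points of the edge [s], for [b] equal to 0 and 1; the factor [eitv_dim (s i)]
   confines the shift to coordinate [j]. *)
pose end_ b : T := [ffun i => eitv_of (s i) (eitv_left (s i) + b * eitv_dim (s i))%N 0].
have endP b i : (b <= 1)%N -> eitv_left (end_ b i) = (eitv_left (s i) + b * eitv_dim (s i))%N
    /\ eitv_dim (end_ b i) = 0%N.
  move=> b1; rewrite ffunE; apply: eitv_ofP => //; rewrite addn0.
  by have := eitv_right_le (s i); rewrite eitv_dimE; nia.
have end_off b i : (b <= 1)%N -> i != j -> end_ b i = s i.
  move=> b1 ij; have [l0 d0] := endP b i b1.
  by apply: eitv_inj; rewrite ?l0 ?d0 soff // muln0 addn0.
have end_facet b : (b <= 1)%N -> cube_facet (end_ b) s.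
  move=> b1; have [l0 d0] := endP b j b1; apply: (cube_facetI (j := j)) => //.
    by rewrite /eitv_face !eitv_dimE l0 d0 sj; lia.
  by move=> i; apply: end_off.
rewrite (bigD1 (end_ 0%N)) ?end_facet //= (bigD1 (end_ 1%N)) /=; last first.
  rewrite end_facet //=; apply/eqP => /(congr1 (fun t : T => eitv_left (t j))).
  by have [-> _] := endP 0%N j isT; have [-> _] := endP 1%N j isT; rewrite sj; lia.
rewrite big_pred0 ?addr0 ?F2_addrr // => t; apply/negP => /andP[/andP[ts /eqP t0] /eqP t1].
have [i [ti ti0 si toff]] := cube_facetP ts.
have ij : i = j by apply/eqP; apply: contraT => /soff; rewrite si.
have tE b : (b <= 1)%N -> eitv_left (t j) = (eitv_left (s j) + b)%N -> t = end_ b.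
  move=> b1 tb; apply/ffunP => l; have [->|lj] := eqVneq l j; last first.
    by rewrite end_off // toff // ij.
  by have [l0 d0] := endP b j b1; apply: eitv_inj; rewrite ?l0 ?d0 -?ij // ij tb sj muln1.
move: ti; rewrite /eitv_face !eitv_dimE ij sj -ij ti0 ij => ti.
have [E|E] : eitv_left (t j) = (eitv_left (s j) + 0)%N \/
             eitv_left (t j) = (eitv_left (s j) + 1)%N by lia.
  by case: t0; apply: tE.
by case: t1; apply: tE.
Qed.

Lemma aug_boundaries c : c \in boundaries [set: T] 0 -> aug c = 0.
Proof.
rewrite boundariesE => /memv_imgP[{}c /cspanP c1 ->]; rewrite lfunE /= /aug.
under eq_bigr do rewrite ffunE.
rewrite (exchange_big_dep predT) //=; apply: big1 => s _.
case: (boolP (s \in cells setT (0 + 1))) => [|/c1 ->]; last by rewrite big1.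
by rewrite !inE add0r => /eqP[/sum_endpoints].
Qed.

Lemma dim_aug P : \dim (linfun aug @: cspan P) = (P != set0) :> nat.
Proof.
have [->|/set0Pn[s sP]] := eqVneq P set0.
  apply/eqP; rewrite dimv_eq0 -subv0; apply/subvP => _ /memv_imgP[c /cspanP c0 ->].
  rewrite memv0 lfunE /= /aug; apply/eqP/big1 => s _.
  by rewrite c0 // inE.
apply/eqP; rewrite eqn_leq; apply/andP; split.
  by apply: leq_trans (dimvS (subvf _)) _; rewrite dimvf.
rewrite lt0n dimv_eq0; apply: contraT; rewrite negbK => /eqP E.
have := memv_img (linfun aug) (memv_cube_chain sP); rewrite E memv0 lfunE /= /aug.
rewrite (bigD1 s) //= ffunE eqxx big1 ?addr0 // => t ts.
by rewrite ffunE (negPf ts).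
Qed.

Lemma cycles0 Y : cycles Y 0 = cspan (cells Y 0).
Proof.
rewrite /cycles chainsE; apply/capv_idPl/subvP => c /cspanP cY.
rewrite memv_ker lfunE /=; apply/eqP/ffunP => t; rewrite !ffunE; apply: big1 => s.
by case/andP=> _ /eqP ts; apply: cY; rewrite inE ts andbF.
Qed.

(** Connectedness of the box, by dimensions: the kernel of the augmentation has codimension one in
    the 0-chains, and by [box_irank] the boundaries have codimension at most one. *)
Lemma boundaries0 : boundaries [set: T] 0 =
  (cspan (cells [set: T] 0) :&: lker (linfun aug))%VS.
Proof.
apply/eqP; rewrite eqEdim dim_boundaries; apply/andP; split.
  rewrite subv_cap -cycles0 boundaries_cycles.
  by apply/subvP => c /aug_boundaries c0; rewrite memv_ker lfunE /= c0.
have := box_irank 0; have := limg_ker_dim (linfun aug) (cspan (cells [set: T] 0)).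
rewrite dim_aug dim_cspan.
have -> : irank [set: T] (cells setT 0) = 0%N.
  have := dim_cycles 0; rewrite cycles0 dim_cspan => /eqP.
  by rewrite -[X in _ == X]addn0 eqn_add2l => /eqP.
have -> : cells [set: T] 0 != set0.
  have [o oo] := ex_origin; apply/set0Pn; exists o.
  by rewrite !inE origin_dim.
by move: (irank _ _) (\dim _) #|_|; move=> *; lia.
Qed.

(** Only the class of a vertex survives in the box. This counts the infinite bars of both
    filtrations. *)
Lemma betti_box k Y : betti k Y setT = (k == 0) && (cells Y 0 != set0) :> nat.
Proof.
rewrite /betti; have [->|k0] /= := eqVneq k 0; last first.
  rewrite -box_acyclic // (capv_idPl _) ?subnn //.
  exact/cyclesS/subsetT.
have sYT : (cspan (cells Y 0) <= cspan (cells [set: T] 0))%VS.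
  apply: sub_span => c /mapP[s sY ->]; apply: map_f; move: sY.
  by rewrite !mem_enum !inE => /andP[_ ->].
rewrite cycles0 boundaries0 capvA (capv_idPl sYT).
by rewrite -(limg_ker_dim (linfun aug) (cspan _)) addKn dim_aug.
Qed.

End Box.

(** * Dual cells *)

Lemma in_cells (d : nat) (a : 'I_d -> nat) (X : {set cube a}) k s :
  (s \in cells X k) = (s \in X) && ((cube_dim s)%:Z == k).
Proof. by rewrite inE. Qed.

Lemma eitv_dual_ex a (x : eitv a) : exists y : eitv a.+1,
  (eitv_left y == eitv_right x) && (eitv_dim y == 1 - eitv_dim x)%N.
Proof.
have := eitv_right_le x; have := eitv_dim_le1 x; rewrite eitv_dimE => x1 xa.
have [||y yl yd] := @eitv_ex a.+1 (eitv_left x + eitv_dim x) (1 - eitv_dim x).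
- by lia.
- by lia.
by exists y; rewrite yl yd !eqxx.
Qed.

(** The pixel [l, l + 1] becomes the vertex l + 1, shifted by the padding; the point l, between the
    pixels l - 1 and l, becomes the edge [l, l + 1] joining their vertices. *)
Definition eitv_dual a (x : eitv a) : eitv a.+1 := xchoose (eitv_dual_ex x).

Lemma eitv_dual_left a (x : eitv a) : eitv_left (eitv_dual x) = eitv_right x.
Proof. by have /andP[/eqP] := xchooseP (eitv_dual_ex x). Qed.

Lemma eitv_dual_dim a (x : eitv a) : eitv_dim (eitv_dual x) = (1 - eitv_dim x)%N.
Proof. by have /andP[_ /eqP] := xchooseP (eitv_dual_ex x). Qed.

Lemma eitv_dual_face a (x y : eitv a) :
  eitv_face (eitv_dual x) (eitv_dual y) = eitv_face y x.
Proof.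
rewrite /eitv_face !eitv_dimE !eitv_dual_left !eitv_dual_dim !eitv_dimE.
have := eitv_dim_le1 x; have := eitv_dim_le1 y => ? ?.
by apply/andP/andP => -[? ?]; split; lia.
Qed.

Lemma eitv_dual_inj a : injective (@eitv_dual a).
Proof.
move=> x y xy; have := congr1 (@eitv_left _) xy; have := congr1 (@eitv_dim _) xy.
rewrite !eitv_dual_left !eitv_dual_dim !eitv_dimE.
have := eitv_dim_le1 x; have := eitv_dim_le1 y => ? ? ? ?.
by apply: eitv_inj; lia.
Qed.

(** The hypotheses exclude exactly the end points 0 and a + 1. *)
Lemma eitv_dual_codom a (y : eitv a.+1) :
  (0 < eitv_right y)%N -> (eitv_left y <= a)%N -> exists x, y = eitv_dual x.
Proof.
rewrite eitv_dimE => y0 ya; have := eitv_right_le y; have := eitv_dim_le1 y.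
rewrite eitv_dimE => y1 ya'.
have [||x xl xd] := @eitv_ex a (eitv_left y + eitv_dim y).-1 (1 - eitv_dim y).
- by lia.
- by lia.
by exists x; apply: eitv_inj; rewrite ?eitv_dual_left ?eitv_dual_dim ?eitv_dimE ?xl ?xd; lia.
Qed.

Section Duality.
Variables (d : nat) (n : 'I_d -> nat).
Local Notation n2 := (fun i => (n i).+2.-1).
Implicit Types (s t : cube n) (A B : {set cube n}).

Definition cube_dual s : cube n2 := [ffun i => eitv_dual (s i)].

Lemma cube_dual_inj : injective cube_dual.
Proof.
move=> s t /ffunP st; apply/ffunP => i; apply: eitv_dual_inj.
by have := st i; rewrite !ffunE.
Qed.

Lemma cube_dual_face s t : cube_face (cube_dual s) (cube_dual t) = cube_face t s.
Proof.
apply/cube_faceP/cube_faceP => H i; have := H i; rewrite ?ffunE ?eitv_dual_face //.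
Qed.

Lemma cube_dual_dim s : (cube_dim (cube_dual s) + cube_dim s = d)%N.
Proof.
rewrite -big_split /= -[RHS]card_ord -sum1_card; apply: eq_bigr => i _.
by rewrite ffunE eitv_dual_dim subnK // eitv_dim_le1.
Qed.

Lemma cube_dual_facet s t : cube_facet (cube_dual s) (cube_dual t) = cube_facet t s.
Proof.
rewrite /cube_facet cube_dual_face; congr (_ && _).
have := cube_dual_dim s; have := cube_dual_dim t.
by move: (cube_dim _) (cube_dim _) (cube_dim _) (cube_dim _) => *; lia.
Qed.

(* The complement of the open star dual to [A]. *)
Definition dual_compl A : {set cube n2} := ~: (cube_dual @: A).

Lemma mem_dual_compl A s : (cube_dual s \in dual_compl A) = (s \notin A).
Proof. by rewrite inE (mem_imset _ _ cube_dual_inj). Qed.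

Lemma dual_complPn A (t : cube n2) :
  t \notin dual_compl A -> exists2 s, s \in A & t = cube_dual s.
Proof. by rewrite inE negbK => /imsetP. Qed.

Definition face_closed (Y : {set cube n2}) : Prop :=
  forall x y, cube_face x y -> y \in Y -> x \in Y.

(** In a nonzero entry of the left block, the row cell lies outside [dual_compl B], hence is a dual
    cell; by face-closedness so is the column cell, which has it as a face. Thus [irank_tr] applies
    although [cube_dual] misses the boundary of the box. *)
Lemma dual_irank A B (i k : int) : face_closed (dual_compl B) ->
  i + k + 1 = d%:Z ->
  irank (~: cells (dual_compl B) i) (cells (dual_compl A) (i + 1)) =
  irank (~: cells A k) (cells B (k + 1)).
Proof.
move=> Bcl ikd; apply: (irank_tr cube_dual_inj) => [t s|t s].
  rewrite cube_dual_facet andbA [RHS]andbA.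
  case: (boolP (cube_facet t s)) => [/andP[_ /eqP st]|]; last by rewrite !andbF.
  rewrite !andbT !in_setC !in_cells !mem_dual_compl.
  have := cube_dual_dim s; have := cube_dual_dim t; rewrite st.
  move: (cube_dim (cube_dual s)) (cube_dim (cube_dual t)) (cube_dim t) => es et dt Et Es.
  have -> : (dt%:Z == k) = (et%:Z == i + 1) by lia.
  have -> : (dt.+1%:Z == k + 1) = (et%:Z == i + 1) by lia.
  have -> : (es%:Z == i) = (et%:Z == i + 1) by lia.
  by case: (t \in A); case: (s \in B); case: (et%:Z == i + 1).
rewrite in_setC !in_cells => tB /andP[_ /eqP si] /andP[ts /eqP st].
have tY : t \notin dual_compl B.
  apply: contraNN tB => ->; move: si; rewrite st; case: (cube_dim t) => *; lia.
have [t' _ ->] := dual_complPn tY.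
have sY : s \notin dual_compl B by apply: contraNN tY; apply: Bcl.
have [s' _ ->] := dual_complPn sY.
by split; apply: codom_f.
Qed.

Lemma card_dual_cells A (j k : int) : j + k = d%:Z ->
  #|cells [set: cube n2] j| = (#|cells (dual_compl A) j| + #|cells A k|)%N.
Proof.
move=> jk; rewrite -(card_imset (mem (cells A k)) cube_dual_inj).
rewrite -(cardsID (dual_compl A)); congr (_ + _)%N.
  by apply: eq_card => s; rewrite !inE andbC.
apply: eq_card => s; rewrite !inE; apply/andP/imsetP => [[]|[t]].
  rewrite negbK => /imsetP[t tA ->] /= dt; exists t => //; rewrite inE tA /=.
  by have := cube_dual_dim t; move: (cube_dim _) dt => *; lia.
rewrite inE => /andP[tA dt] ->; rewrite negbK imset_f //; split=> //=.
by have := cube_dual_dim t; move: (cube_dim _) => *; lia.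
Qed.

(** The added term is the degree 0 class that reduced homology removes. The condition [k != d] keeps
    [i + 1] away from 0, the one degree where the box has homology. *)
Lemma dual_betti A B (k : int) : k != d%:Z ->
  face_closed (dual_compl A) -> face_closed (dual_compl B) ->
  betti (d%:Z - k - 1) (dual_compl B) (dual_compl A) =
  (betti k A B + ((d%:Z - k - 1 == 0)%R && (cells (dual_compl B) 0 != set0)))%N.
Proof.
move=> kd Acl Bcl.
set i := (d%:Z - k - 1).
have ik : i + k + 1 = d%:Z by rewrite /i; lia.
have j0 : (i + 1 == 0) = false by apply/negP => /eqP; lia.
have full : dual_compl set0 = setT by rewrite /dual_compl imset0 setC0.
have rows0 m : ~: cells (set0 : {set cube n}) m = setT.
  by apply/setP => s; rewrite !inE.
have full_cells m : irank (~: cells [set: cube n2] m) (cells [set: cube n2] (m + 1)) = 0%N.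
  rewrite /irank (_ : incidence _ _ = 0) ?mxrank0 //; apply/matrixP => t s.
  rewrite !mxE; case: (boolP (cube_facet _ _)) => [/andP[_ /eqP st]|]; last by rewrite !andbF.
  rewrite !inE st; case: eqP => //= tm; case: eqP => //; lia.
(* [E1] and [E2] are the two sides, and [R2] matches their mixed blocks. [E3] and [E4], with [R3]
   and [R4], relate the ranks with all rows on one side to those on the other, and [E5] with [C]
   eliminates the ranks of the box itself. *)
have E1 := betti_irank k A B.
have E2 := betti_irank i (dual_compl B) (dual_compl A).
have E3 := betti_irank i (dual_compl B) [set: cube n2].
have E4 := betti_irank (i + 1) (dual_compl A) [set: cube n2].
have E5 := betti_irank (i + 1) [set: cube n2] [set: cube n2].
have R2 := @dual_irank A B i k Bcl ik.
have R3 := @dual_irank set0 B i k Bcl ik.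
have ik' : i + 1 + (k - 1) + 1 = d%:Z by lia.
have R4 := @dual_irank set0 A (i + 1) (k - 1) Acl ik'.
have ik2 : i + 1 + k = d%:Z by lia.
have C := @card_dual_cells A (i + 1) k ik2.
rewrite full rows0 in R3; rewrite full rows0 (_ : k - 1 + 1 = k) in R4; last by lia.
rewrite betti_box in E3; rewrite betti_box j0 in E4; rewrite betti_box j0 full_cells in E5.
rewrite R2 in E2; rewrite R3 in E3; rewrite R4 in E4; rewrite C in E5.
move: E1 E2 E3 E4 E5; rewrite /= -/i.
move: (betti _ _ _) (betti _ _ _) (nat_of_bool _).
do ?[move: (irank _ _)]; do ?[move: #|pred_of_set _|].
by move=> *; lia.
Qed.

End Duality.

(** * The two filtrations of an image *)

Section Extrema.
Variables (R : realType) (T : finType) (P : pred T) (F : T -> R).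

Lemma max_over_leP (x0 : T) (v : R) : P x0 ->
  reflect (forall x, P x -> F x <= v) (max_over P F <= v).
Proof.
rewrite /max_over; case: pickP => [x Px|/(_ x0) -> //] _.
apply: (iffP (bigmax_leP _ _ _ _)) => [[_ H] //|H]; split=> //; exact: H.
Qed.

Lemma min_over_geP (x0 : T) (v : R) : P x0 ->
  reflect (forall x, P x -> v <= F x) (v <= min_over P F).
Proof.
rewrite /min_over; case: pickP => [x Px|/(_ x0) -> //] _.
apply: (iffP (bigmin_geP _ _ _ _)) => [[_ H] //|H]; split=> //; exact: H.
Qed.

Lemma min_over_ltP (x0 : T) (v : R) : P x0 ->
  reflect (exists2 x, P x & F x < v) (min_over P F < v).
Proof.
move=> Px0; rewrite ltNge; apply: (iffP idP) => [|[x Px xv]].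
  move=> H; apply/exists_inP; apply: contraNT H => /exists_inPn H.
  by apply/(min_over_geP _ Px0) => x Px; rewrite leNgt H.
by apply/(min_over_geP _ Px0) => /(_ x Px); rewrite leNgt xv.
Qed.

End Extrema.

(** Strict, because [- I q <= - b] fails exactly when [I q < b]. *)
Definition strict_sublevel (R : realType) d (a : 'I_d -> nat) (f : cube a -> R) (u : R) :
  {set cube a} := [set s | f s < u].

Section Grid.
Variables (d : nat) (n : 'I_d -> nat).
Local Notation n2 := (fun i => (n i).+2).
Implicit Types (s : cube n) (p : grid n2) (q : grid n).

Lemma pixel_of s : (forall i, (0 < n i)%N) -> exists q, cube_face s (Tcube q).
Proof.
(* The pixel starting at the left end of [s i], except that the last point [n i] is only an end of
   the pixel [n i - 1]. *)
move=> n_gt0; have H i : (minn (eitv_left (s i)) (n i).-1 < n i)%N by have := n_gt0 i; lia.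
exists [ffun i => Ordinal (H i)]; apply/cube_faceP => i; rewrite !ffunE.
have := eitv_right_le (s i); have := eitv_dim_le1 (s i); have := n_gt0 i.
rewrite /eitv_face !eitv_dimE /eitv_left /eitv_dim /= => ? ? ?.
by apply/andP; split; lia.
Qed.

Lemma pixel_ex : (forall i, (0 < n i)%N) -> exists q : grid n, true.
Proof.
move=> n_gt0; have H i : (0 < n i)%N := n_gt0 i.
by exists [ffun i => Ordinal (H i)].
Qed.

Lemma vertex_of (y : cube (fun i => (n2 i).-1)) : exists p, cube_face (Vvertex p) y.
Proof.
have H i : (eitv_left (y i) < n2 i)%N.
  by have := eitv_right_le (y i); rewrite eitv_dimE /=; lia.
exists [ffun i => Ordinal (H i)]; apply/cube_faceP => i; rewrite !ffunE.
rewrite /eitv_face !eitv_dimE /eitv_left /eitv_dim /=.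
by apply/andP; split; lia.
Qed.

Definition shift q : grid n2 := [ffun i => lift ord0 (widen_ord (leqnSn _) (q i))].

Lemma shiftE q i : shift q i = (q i).+1 :> nat.
Proof. by rewrite ffunE. Qed.

Lemma Vvertex_shift q : Vvertex (shift q) = cube_dual (Tcube q).
Proof.
apply/ffunP => i; rewrite !ffunE; apply: eitv_inj.
  by rewrite eitv_dual_left eitv_dimE /eitv_left /eitv_dim /= addn1.
by rewrite eitv_dual_dim.
Qed.

Lemma shift_vertex_dual q y : cube_face (Vvertex (shift q)) y -> exists s, y = cube_dual s.
Proof.
rewrite Vvertex_shift => /cube_faceP qy.
have /fin_all_exists[f fE] : forall i, exists x, y i = eitv_dual x.
  move=> i; apply: eitv_dual_codom; have := qy i; rewrite !ffunE /eitv_face;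
  rewrite !eitv_dimE !eitv_dual_left eitv_dual_dim !eitv_dimE /eitv_left /eitv_dim /=;
  have := ltn_ord (q i); move=> ? /andP[]; lia.
by exists [ffun i => f i]; apply/ffunP => i; rewrite !ffunE fE.
Qed.

End Grid.

Section Image.
Variables (R : realType) (d : nat) (n : 'I_d -> nat) (I : gsimage R n) (N : R).
Hypotheses (d_gt0 : (0 < d)%N) (n_gt0 : forall i, (0 < n i)%N).
Hypothesis (I_lt_N : max_over xpredT I < N).
Local Notation n2 := (fun i => (n i).+2).
Local Notation T := (Tfun I).
Local Notation V := (Vfun (negim (pad I N))).
Implicit Types (s : cube n) (p : grid n2) (q : grid n).

Lemma Tfun_geP s v : reflect (forall q, cube_face s (Tcube q) -> v <= I q) (v <= Tfun I s).
Proof using n_gt0.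
exact: (@min_over_geP R _ (fun q => cube_face s (Tcube q)) I _ v
  (xchooseP (pixel_of s n_gt0))).
Qed.

Lemma Tfun_ltP s v : reflect (exists2 q, cube_face s (Tcube q) & I q < v) (Tfun I s < v).
Proof using n_gt0.
exact: (@min_over_ltP R _ (fun q => cube_face s (Tcube q)) I _ v
  (xchooseP (pixel_of s n_gt0))).
Qed.

Lemma image_lt_N q : I q < N.
Proof using I_lt_N. apply: le_lt_trans I_lt_N.
have := lexx (max_over xpredT I).
by move/(max_over_leP (P := xpredT) I (x0 := q) _ isT); apply. Qed.

Lemma Vfun_leP y v :
  reflect (forall p, cube_face (Vvertex p) y -> - pad I N p <= v) (V y <= v).
Proof using.
exact: (@max_over_leP R _ (fun p => cube_face (Vvertex p) y) (negim (pad I N)) _ v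
  (xchooseP (vertex_of y))).
Qed.

Lemma pad_shift q : pad I N (shift q) = I q.
Proof.
rewrite /pad; case: pickP => [q' /forallP q'E|/(_ q)/forallP[i]]; last by rewrite shiftE.
congr I; apply/ffunP => i; apply/ord_inj/succn_inj.
by rewrite -(eqP (q'E i)) shiftE.
Qed.

Lemma pad_spec p : (exists2 q, p = shift q & pad I N p = I q) \/
  (forall q, p <> shift q) /\ pad I N p = N.
Proof.
rewrite /pad; case: pickP => [q /forallP qE|none]; [left | right].
  by exists q => //; apply/ffunP => i; apply/ord_inj; rewrite (eqP (qE i)) shiftE.
split=> // q pq; have /forallP[i] := negbT (none q).
by rewrite pq shiftE.
Qed.

(** As [b <= N], padding vertices impose no condition. A cell with an image vertex is dual to some
    [s], and its image vertices are dual to the pixels around [s], so the maximum of [- I] over the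
    former is minus the minimum of [I] over the latter. *)
Lemma sublevel_dual b : b <= N -> sublevel V (- b) = dual_compl (strict_sublevel T b).
Proof using n_gt0.
move=> bN; apply/setP => y; rewrite [LHS]inE.
apply/Vfun_leP/idP => [H|yb p py].
  apply/negPn/negP => /dual_complPn[s]; rewrite inE ltNge => /negP sb yE; apply: sb.
  apply/Tfun_geP => q sq; rewrite -pad_shift -lerN2; apply: H.
  by rewrite Vvertex_shift yE cube_dual_face.
rewrite lerN2; have [[q pE ->]|[_ -> //]] := pad_spec p.
rewrite pE in py; have [s yE] := shift_vertex_dual py.
move: py yb; rewrite yE Vvertex_shift cube_dual_face mem_dual_compl inE -leNgt => sq.
by move/Tfun_geP; apply.
Qed.

Lemma V_closed r : face_closed (sublevel V r).
Proof using.
move=> x y xy; rewrite !inE.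
move/Vfun_leP => H; apply/Vfun_leP => p px; apply: H.
exact: cube_face_trans px xy.
Qed.

Lemma T_sublevel_full b : N <= b -> strict_sublevel T b = setT.
Proof using n_gt0 I_lt_N.
move=> Nb; apply/setP => s; rewrite !inE; have [q sq] := pixel_of s n_gt0.
apply/Tfun_ltP; exists q => //.
exact: lt_le_trans (image_lt_N q) Nb.
Qed.

Lemma T_vertex b : (cells (strict_sublevel T b) 0 != set0) = (min_over xpredT I < b).
Proof using n_gt0.
have [q0 _] := pixel_ex n_gt0.
apply/set0Pn/(@min_over_ltP R _ xpredT I q0 b isT) => [[s]|[q _ qb]].
  by rewrite !inE => /andP[/Tfun_ltP[q _ qb] _]; exists q.
have /fin_all_exists[f fE] i : exists x : eitv (n i), eitv_left x = q i /\ eitv_dim x = 0%N.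
  have [||x xl xd] := @eitv_ex (n i) (q i) 0; rewrite ?addn0 //; first exact: ltnW.
  by exists x.
have fq : cube_face [ffun i => f i] (Tcube q).
  apply/cube_faceP => i; rewrite !ffunE /eitv_face !eitv_dimE.
  by have [-> ->] := fE i; rewrite /eitv_left /= addn0 leqnn leq_addr.
exists [ffun i => f i]; rewrite !inE; apply/andP; split.
  by apply/Tfun_ltP; exists q.
by rewrite /cube_dim big1 // => i _; rewrite ffunE; have [] := fE i.
Qed.

Lemma V_sublevel0 r : r < - N -> sublevel V r = set0.
Proof using I_lt_N.
move=> rN; apply/setP => y; rewrite !inE; apply/negP.
have [p py] := vertex_of y; move/Vfun_leP/(_ p py) => pr.
have := le_lt_trans pr rN; rewrite ltrN2 ltNge.
by have [[q _ ->]|[_ ->]] := pad_spec p; rewrite ?lexx // ltW ?image_lt_N.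
Qed.

(** The origin of the padded box is not a dual cell, so it is already present at [- N]; this takes a
    coordinate, hence [d > 0]. *)
Lemma V_vertex r : - N <= r -> cells (sublevel V r) 0 != set0.
Proof.
move=> Nr; have [o oo] := ex_origin (fun i => (n2 i).-1).
apply/set0Pn; exists o; rewrite in_cells origin_dim // eqxx andbT.
apply: (subsetP (sublevelS _ Nr)); rewrite sublevel_dual //.
apply/negPn/negP => /dual_complPn[s _ os].
have /forallP/(_ (Ordinal d_gt0)) := oo.
rewrite os ffunE /eitv_code eitv_dual_left eitv_dual_dim eitv_dimE.
by have := eitv_dim_le1 (s (Ordinal d_gt0)); lia.
Qed.

End Image.

(** * Barcodes are determined by ranks *)

Lemma count_split (T : eqType) (s : seq T) (P Q S : pred T) :
  {in s, forall x, P x + Q x = S x :> nat}%N -> (count P s + count Q s = count S s)%N.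
Proof.
elim: s => //= x s IH PQS; rewrite addnACA PQS ?mem_head // IH // => y ys.
by apply: PQS; rewrite inE ys orbT.
Qed.

Section Barcodes.
Variable R : realType.
Implicit Types (D L : seq (lbar R)) (x y : lbar R) (r s u v : R) (k : int).

Lemma gap_below (s : seq R) u : exists2 r, r < u & {in s, forall z, z < u -> z <= r}.
Proof.
elim: s => [|z s [r ru rs]]; first by exists (u - 1); rewrite // ltrBlDr ltrDl.
have [zu|uz] := ltP z u; last first.
  by exists r => // w; rewrite inE => /predU1P[->|/rs //]; rewrite ltNge uz.
exists (Num.max z r); rewrite ?gt_max ?zu //= => w; rewrite inE.
by case/predU1P => [->|/rs wr /wr wr']; rewrite le_max ?lexx // wr' orbT.
Qed.

Lemma gap_above (s : seq R) u v : u < v ->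
  exists r, [/\ u < r, r <= v & {in s, forall z, u < z -> r <= z}].
Proof.
move=> uv; elim: s => [|z s [r [ur rv rs]]]; first by exists v.
have [uz|zu] := ltP u z; last first.
  by exists r; split=> // w; rewrite inE => /predU1P[->|/rs //]; rewrite ltNge zu.
exists (Num.min z r); rewrite lt_min uz ur ge_min rv orbT; split=> // w; rewrite inE.
by case/predU1P => [->|/rs wr /wr wr']; rewrite ge_min ?lexx // wr' orbT.
Qed.

Lemma strict_bound (s : seq R) u : exists2 r, u <= r & {in s, forall z, z < r}.
Proof.
elim: s => [|z s [r ur rs]]; first by exists u.
exists (Num.max r (z + 1)); rewrite ?le_max ?ur //= => w; rewrite inE lt_max.
by case/predU1P => [->|/rs -> //]; rewrite ltrDl ltr01 orbT.
Qed.

Definition starts D := [seq x.2.1 | x <- D].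
Definition ends D := [seq fine x.2.2 | x <- D].

Lemma mem_starts D x : x \in D -> x.2.1 \in starts D.
Proof. exact: (map_f (fun x : lbar R => x.2.1)). Qed.

Lemma mem_ends D x : x \in D -> fine x.2.2 \in ends D.
Proof. exact: (map_f (fun x : lbar R => fine x.2.2)). Qed.

(* The bars in degree [k] which are alive at [r] for some [r < u] arbitrarily
   close to [u], and still alive just before [v]. *)
Definition quadrant k u v x : bool := [&& x.1 == k, x.2.1 < u & (v%:E <= x.2.2)%E].
Definition immortal k u x : bool := [&& x.1 == k, x.2.1 < u & x.2.2 == +oo%E].

(** Inclusion-exclusion isolates the bars starting in [u, u') and ending in [v, v'); the gap
    hypotheses leave [u, v) as the only candidate. *)
Lemma quadrant_moebius k u v u' v' D :
  {in D, forall x, (x.2.2 < +oo)%E && (x.2.1%:E < x.2.2)%E} ->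
  u < u' -> {in starts D, forall z, u < z -> u' <= z} ->
  v < v' -> {in ends D, forall z, v < z -> v' <= z} ->
  (count_mem (k, (u, v%:E)) D + count (quadrant k u v) D + count (quadrant k u' v') D =
   count (quadrant k u' v) D + count (quadrant k u v') D)%N.
Proof.
move=> fD uu' sD vv' eD; rewrite -!addnA.
elim: D fD sD eD => //= x D IH fD sD eD.
have tl (T : eqType) (a b : T) (l : seq T) : b \in l -> b \in a :: l.
  by rewrite inE orbC => ->.
have {}IH := IH (fun y yD => fD y (tl _ _ _ _ yD)) (fun z zD => sD z (tl _ _ _ _ zD))
   (fun z zD => eD z (tl _ _ _ _ zD)).
suff E : ((x == (k, (u, v%:E)))%B + quadrant k u v x + quadrant k u' v' x =
          quadrant k u' v x + quadrant k u v' x)%N.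
  move: E IH; do ?[move: (count _ _)]; do ?[move: (nat_of_bool _)]; move=> *; lia.
have := fD x (mem_head _ _); have := sD x.2.1 (mem_head _ _).
have := eD (fine x.2.2) (mem_head _ _).
case: x {fD sD eD} => k' [x [y| |]] //= ey sx /andP[_ xy].
rewrite /quadrant /= !lee_fin !xpair_eqE /=; case: eqP => //= _.
have -> : (y%:E == v%:E) = (y == v) by [].
have -> : (x < u') = (x == u) || (x < u).
  rewrite -le_eqVlt; apply/idP/idP => [xu'|/le_lt_trans -> //].
  by rewrite leNgt; apply/negP => /sx; rewrite leNgt xu'.
have -> : (v <= y) = (y == v) || (v' <= y).
  rewrite eq_sym le_eqVlt; congr (_ || _).
  by apply/idP/idP => [/ey //|]; apply: lt_le_trans.
have xu : x == u -> (x < u) = false by move/eqP->; rewrite ltxx.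
have yv : y == v -> (v' <= y) = false by move/eqP->; rewrite lt_geF.
case: (x == u) xu => [/(_ isT) ->|_]; case: (y == v) yv => [/(_ isT) ->|_] //=;
  by case: (x < u); case: (v' <= y).
Qed.

Lemma perm_quadrants D D' :
  {in D ++ D', forall x, (x.2.2 < +oo)%E && (x.2.1%:E < x.2.2)%E} ->
  (forall k u v, u <= v -> count (quadrant k u v) D = count (quadrant k u v) D') ->
  perm_eq D D'.
Proof.
move=> fD qD; apply/allP => x xD /=; have := fD x xD; case: x xD => k [u [v| |]] //= xD.
(* Taking [u'] at most [v] keeps all four corners in the region where the counts are assumed
   equal. *)
rewrite lte_fin => /andP[_ uv]; have [u' [uu' u'v su']] := gap_above (starts (D ++ D')) uv.
have vv1 : v < v + 1 by rewrite ltrDl.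
have [v' [vv' _ ev']] := gap_above (ends (D ++ D')) vv1.
have sub D1 : {subset D1 <= D ++ D'} ->
  (count_mem (k, (u, v%:E)) D1 + count (quadrant k u v) D1 + count (quadrant k u' v') D1 =
   count (quadrant k u' v) D1 + count (quadrant k u v') D1)%N.
  move=> D1D; apply: quadrant_moebius => // [x /D1D /fD //|z|z] /mapP[x /D1D xD' ->].
    exact/su'/map_f.
  exact/ev'/map_f.
have u'v' := le_trans u'v (ltW vv').
have uv' := le_trans (ltW uv) (ltW vv').
have E : {subset D <= D ++ D'} by move=> x xD'; rewrite mem_cat xD'.
have E' : {subset D' <= D ++ D'} by move=> x xD'; rewrite mem_cat xD' orbT.
have := sub D E; have := sub D' E'; rewrite !qD // ?(ltW uv) //.
by move: (count_mem _ D) (count_mem _ D'); do ?[move: (count _ _)]; move=> *; apply/eqP; lia.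
Qed.

Section Diagram.
Variables (d : nat) (a : 'I_d -> nat) (f : cube a -> R) (D : seq (lbar R)).
Hypothesis fD : is_dgm f D.

(** Ranks are read off at closed levels; since [f] and the bars involve finitely many values, a
    closed level just below [u] acts as the strict one. The list [l] holds further values below [u]
    that [r] must not pass. *)
Lemma strict_sublevel_lim (l : seq R) u : exists r,
  [/\ r < u, sublevel f r = strict_sublevel f u, {in l, forall z, z < u -> z <= r},
      {in D, forall x, (x.2.1 <= r) = (x.2.1 < u)} &
      {in D, forall x, (r%:E < x.2.2)%E = (u%:E <= x.2.2)%E}].
Proof.
have [r ru rl] := gap_below (l ++ codom f ++ starts D ++ ends D) u.
have {}rl z : z \in l ++ codom f ++ starts D ++ ends D -> (z <= r) = (z < u).
  by move=> zl; apply/idP/idP => [/le_lt_trans -> //|]; apply: rl.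
exists r; split=> //.
- by apply/setP => s; rewrite !inE rl // !mem_cat codom_f orbT.
- by move=> z zl zu; rewrite rl // mem_cat zl.
- by move=> x xD; rewrite rl // !mem_cat mem_starts // !orbT.
move=> x xD; have := rl (fine x.2.2); rewrite !mem_cat mem_ends // !orbT.
case: x.2.2 => [y| |] /= H; rewrite ?lte_fin ?lee_fin ?ltry ?leey //.
by rewrite ltNge H // -leNgt.
Qed.

Lemma whole_sublevel u : exists r,
  [/\ u <= r, sublevel f r = setT & {in D, forall x, (r%:E < x.2.2)%E = (x.2.2 == +oo%E)}].
Proof.
have [r ur rl] := strict_bound (codom f ++ ends D) u.
exists r; split=> //.
  by apply/setP => s; rewrite !inE ltW // rl // mem_cat codom_f.
move=> x xD; have := rl (fine x.2.2); rewrite !mem_cat mem_ends // !orbT.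
case: x.2.2 => [y| |] /= H; rewrite ?lte_fin ?ltry //.
by rewrite ltNge ltW // H.
Qed.

Lemma count_quadrant k u v : u <= v ->
  count (quadrant k u v) D = betti k (strict_sublevel f u) (strict_sublevel f v).
Proof.
move=> uv; have [r [ru <- _ rs _]] := strict_sublevel_lim [::] u.
(* Listing [r] ensures [r <= s] even when [u = v]. *)
have [s [sv <- rl _ se]] := strict_sublevel_lim [:: r] v.
have rs' : r <= s by apply: rl; rewrite ?inE // (lt_le_trans ru uv).
rewrite -(count_dgm k fD rs'); apply: eq_in_count => x xD.
by rewrite /quadrant -rs // -se.
Qed.

Lemma count_sublevel_immortal k r :
  count (fun x => [&& x.1 == k, x.2.1 <= r & x.2.2 == +oo%E]) D =
  betti k (sublevel f r) setT.
Proof.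
have [s [rs <- se]] := whole_sublevel r.
rewrite -(count_dgm k fD rs); apply: eq_in_count => x xD.
by rewrite se.
Qed.

Lemma count_immortal k u :
  count (immortal k u) D = betti k (strict_sublevel f u) setT.
Proof.
have [r [_ <- _ rs _]] := strict_sublevel_lim [::] u.
rewrite -count_sublevel_immortal; apply: eq_in_count => x xD.
by rewrite /immortal rs.
Qed.

End Diagram.

Lemma betti_no_cells d (a : 'I_d -> nat) k (X Y : {set cube a}) :
  cells X k = set0 -> betti k X Y = 0%N.
Proof.
move=> X0; have := betti_irank k X Y; rewrite X0 setC0 cards0.
by move: (betti _ _ _); do ?[move: (irank _ _)]; move=> *; lia.
Qed.

End Barcodes.

(** * The duality *)

Section Main.
Variables (R : realType) (d : nat) (n : 'I_d -> nat) (I : gsimage R n) (N : R).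
Variables (DT DV : seq (lbar R)).
Hypotheses (d_gt0 : (0 < d)%N) (n_gt0 : forall i, (0 < n i)%N).
Hypothesis (I_lt_N : max_over xpredT I < N).
Local Notation T := (Tfun I).
Local Notation V := (Vfun (negim (pad I N))).
Local Notation m := (min_over xpredT I).
Hypotheses (dgmT : is_dgm T DT) (dgmV : is_dgm V DV).
Implicit Types (k : int) (u v : R) (x : lbar R).

Lemma min_lt_N : m < N.
Proof.
have [q _] := pixel_ex n_gt0.
by apply/(@min_over_ltP _ _ xpredT I q N isT); exists q => //; apply: image_lt_N.
Qed.

Lemma T_immortal k u : count (immortal k u) DT = (k == 0) && (m < u) :> nat.
Proof. by rewrite (count_immortal dgmT) betti_box T_vertex. Qed.

Lemma V_quadrant k u v : u <= v -> v <= N ->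
  count (fun x => [&& x.1 == d%:Z - k - 1, x.2.1 <= - v & ((- u)%:E < x.2.2)%E]) DV =
  (count (quadrant k u v) DT + (d%:Z - k - 1 == 0)%R)%N.
Proof.
move=> uv vN; have vu : - v <= - u by rewrite lerN2.
have uN := le_trans uv vN.
rewrite (count_dgm _ dgmV vu) (count_quadrant dgmT) //.
rewrite (sublevel_dual I n_gt0 vN) // (sublevel_dual I n_gt0 uN) //.
(* For [k = d] both sides vanish: the dual degree is -1, and without cells of dimension d + 1 the
   rank is the same as for the inclusion into the box, where it is 0. *)
have [->|kd] := eqVneq k d%:Z.
  rewrite (_ : d%:Z - d%:Z - 1 = -1 :> int); last by lia.
  rewrite (betti_no_cells (k := -1)) /=; last by apply/setP => s; rewrite !inE andbF.
  have top (Y : {set cube n}) : cells Y (d%:Z + 1) = set0.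
    apply/setP => s; rewrite !inE; apply/negP => /andP[_ /eqP sd].
    by have := cube_dual_dim s; lia.
  have E1 := betti_irank d%:Z (strict_sublevel T u) (strict_sublevel T v).
  have E2 := betti_irank d%:Z (strict_sublevel T u) setT.
  have d0 : (d%:Z == 0) = false by case: (d) d_gt0.
  rewrite betti_box d0 /= !top in E1 E2; rewrite addn0.
  by move: E1 E2; move: (betti _ _ _); do ?[move: (irank _ _)]; move: #|_| => *; lia.
rewrite dual_betti //.
- rewrite -(sublevel_dual I n_gt0 vN) // V_vertex ?andbT //.
  by rewrite lerN2.
- by rewrite -(sublevel_dual I n_gt0 uN) //; apply: V_closed.
by rewrite -(sublevel_dual I n_gt0 vN) //; apply: V_closed.
Qed.

Lemma V_start x : x \in DV -> - N <= x.2.1.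
Proof.
move=> xD; rewrite leNgt; apply/negP => xN.
have := count_dgm x.1 dgmV (lexx x.2.1); rewrite (V_sublevel0 I_lt_N xN).
rewrite betti_no_cells; last by apply/setP => s; rewrite !inE.
apply/eqP; rewrite -lt0n -has_count; apply/hasP; exists x => //.
rewrite eqxx lexx /=; have [/allP/(_ x xD)] := dgmV.
by [].
Qed.

Lemma V_immortal k r : - N <= r ->
  count (fun x => [&& x.1 == k, x.2.1 <= r & x.2.2 == +oo%E]) DV = (k == 0) :> nat.
Proof. by move=> Nr; rewrite (count_sublevel_immortal dgmV) betti_box V_vertex ?andbT. Qed.

(** Above [N] the complex of [T] is the whole box, so a bar still alive just before a level above
    [N] is infinite. A finite bar ending there would make the count of all living bars exceed that
    of the infinite ones. *)
Lemma T_finite_le x : x \in dgm_fin DT -> fine x.2.2 <= N.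
Proof.
rewrite mem_filter => /andP[xfin xD]; rewrite leNgt; apply/negP => Nx.
have /allP/(_ x xD) := dgmT.1; rewrite /bar_nonempty => xne.
have := count_quadrant dgmT x.1 (lexx (fine x.2.2)).
rewrite [X in betti _ _ X](T_sublevel_full n_gt0 I_lt_N) ?(ltW Nx) //.
rewrite -(count_immortal dgmT).
pose mortal y := quadrant x.1 (fine x.2.2) (fine x.2.2) y && ~~ immortal x.1 (fine x.2.2) y.
rewrite -(@count_split _ _ mortal (immortal x.1 (fine x.2.2))); last first.
  move=> y _; rewrite /mortal; case: (boolP (immortal _ _ y)) => [/and3P[yk yl /eqP yi]|_].
    by rewrite andbF /quadrant yk yl yi leey.
  by rewrite andbT addn0.
suff : has mortal DT.
  by rewrite has_count; move: (count _ _) (count _ _) => *; lia.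
apply/hasP; exists x => //; rewrite /mortal /quadrant /immortal eqxx /=.
by move: xfin xne; case: x.2.2 => [y| |] //= _; rewrite lte_fin => ->; rewrite lexx.
Qed.

Lemma V_finite_quadrant k u v : u <= v -> v <= N ->
  count (quadrant k u v) [seq dual_lbar d x | x <- dgm_fin DV] = count (quadrant k u v) DT.
Proof.
(* The extra summand of [V_quadrant] is the number of infinite bars of [V], so only finite bars
   remain once it is cancelled. *)
move=> uv vN; apply/(@addIn (d%:Z - k - 1 == 0)%R); rewrite -V_quadrant //.
rewrite -(@V_immortal (d%:Z - k - 1) (- v)) ?lerN2 // count_map count_filter.
apply: count_split => x xD; have xne := allP dgmV.1 x xD.
rewrite /quadrant /= (_ : (d%:Z - x.1 - 1 == k) = (x.1 == d%:Z - k - 1)); last by lia.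
case: (x.1 == _) => //=; move: xne; rewrite /bar_nonempty.
case: x.2.2 => [y| |] //= _; rewrite ?ltry ?lee_fin ?lte_fin ?andbT ?andbF //.
  by rewrite ltrNl lerNr andbC addn0.
Qed.

(** The multiplicity of an infinite bar is the jump of the [immortal] count at its start, and by
    [T_immortal] the only jump is a single one at [m] in degree 0. *)
Lemma T_dgm_inf : perm_eq (dgm_inf DT) [:: (0 : int, (m, +oo%E))].
Proof.
apply/allP => x; rewrite mem_cat mem_seq1 => xD.
have xinf : x.2.2 = +oo%E.
  by case/orP: xD => [|/eqP -> //]; rewrite mem_filter => /andP[/eqP].
have [u' [xu' _ su']] := gap_above (m :: starts DT) (ltr_pwDr ltr01 (lexx x.2.1)).
have E : (count_mem x (dgm_inf DT) + count (immortal x.1 x.2.1) DT)%N =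
    count (immortal x.1 u') DT.
  rewrite count_filter; apply: count_split => y yD; rewrite /= /immortal.
  have -> : (y.2.1 < u') = (y.2.1 == x.2.1) || (y.2.1 < x.2.1).
    rewrite -le_eqVlt; apply/idP/idP => [yu'|/le_lt_trans -> //].
    rewrite leNgt; apply/negP => /su'; rewrite inE mem_starts // orbT => /(_ isT).
    by rewrite leNgt yu'.
  move: xinf; case: x {xD xu' su'} => k [b e] /= ->; case: y {yD} => k' [b' e'] /=.
  rewrite !xpair_eqE; case: (k' == k) => //=; case: (eqVneq b' b) => [->|_] //=.
  by rewrite ltxx andbb addn0.
move: E; rewrite !T_immortal.
have -> : (m < u') = (m == x.2.1) || (m < x.2.1).
  rewrite -le_eqVlt; apply/idP/idP => [mu'|/le_lt_trans -> //].
  by rewrite leNgt; apply/negP => /(su' _ (mem_head _ _)); rewrite leNgt mu'.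
case: x xinf {xD su' xu'} => k [b e] /= ->; rewrite !xpair_eqE eqxx andbT eq_sym (eq_sym 0).
case: (k == 0) => /=; last by rewrite -[X in _ -> X == _]addn0 => /eqP.
case: (eqVneq m b) => [->|_] /=; first by rewrite ltxx -[X in _ -> X == _]addn0 => /eqP.
by move/eqP; rewrite -[X in _ == X]add0n eqn_add2r.
Qed.

Lemma T_dgm_fin : perm_eq (dgm_fin DT)
  (rem (0 : int, (m, N%:E)) [seq dual_lbar d x | x <- dgm_fin DV]).
Proof.
set bars := [seq dual_lbar d x | x <- dgm_fin DV].
(* Adding the truncated bar on the left also proves that it occurs among the dual bars, so that
   [rem] does remove a copy. *)
suff E : perm_eq ((0 : int, (m, N%:E)) :: dgm_fin DT) bars.
  have xb : (0 : int, (m, N%:E)) \in bars by rewrite -(perm_mem E) mem_head.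
  by rewrite -(perm_cons (0 : int, (m, N%:E))) (perm_trans E) // perm_to_rem.
have finV x : x \in bars -> [/\ (x.2.2 < +oo)%E, (x.2.1%:E < x.2.2)%E & (x.2.2 <= N%:E)%E].
  case/mapP => y; rewrite mem_filter => /andP[yfin yD] -> /=; rewrite ltry.
  have /allP/(_ y yD) := dgmV.1; rewrite /bar_nonempty.
  rewrite lee_fin lerNl V_start //.
  by move: yfin; case: y.2.2 => [w| |] //= _; rewrite !lte_fin ltrN2.
have finT x : x \in (0 : int, (m, N%:E)) :: dgm_fin DT ->
    [/\ (x.2.2 < +oo)%E, (x.2.1%:E < x.2.2)%E & (x.2.2 <= N%:E)%E].
  rewrite inE => /predU1P[-> /=|xD]; first by rewrite ltry lte_fin min_lt_N.
  have xN := T_finite_le xD; move: xD; rewrite mem_filter => /andP[xfin xD].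
  split=> //; first exact: (allP dgmT.1 x xD).
  by move: xfin xN; case: x.2.2 => [w| |] //= _; rewrite ?lee_fin ?leNye.
apply: perm_quadrants => [x|k u v uv].
  by rewrite mem_cat => /orP[/finT[-> ->]|/finV[-> ->]].
(* All bars on both sides end by [N], so beyond it both counts are zero. *)
have [vN|Nv] := leP v N; last first.
  have none D : (forall x, x \in D ->
        [/\ (x.2.2 < +oo)%E, (x.2.1%:E < x.2.2)%E & (x.2.2 <= N%:E)%E]) ->
      count (quadrant k u v) D = 0%N.
    move=> DN; apply/eqP; rewrite -leqn0 leqNgt -has_count; apply/hasPn => x /DN[_ _ xN].
    by apply/negP => /and3P[_ _ /le_trans/(_ xN)]; rewrite lee_fin leNgt Nv.
  by rewrite !none.
(* Up to [N], the bar [m, N) is counted exactly like the infinite bar of [T], whose count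
   supplements that of [dgm_fin DT] to the count of [DT]. *)
rewrite V_finite_quadrant //= {1}/quadrant /= lee_fin vN andbT (eq_sym 0 k).
rewrite -(T_immortal k u) /dgm_fin count_filter addnC.
apply: count_split => x xD; rewrite /= /immortal /quadrant.
case: (x.1 == k) => //=; case: (x.2.1 < u) => //=.
by case: x.2.2 => [w| |] /=; rewrite ?ltry ?andbT ?addn0 ?leey.
Qed.

End Main.

Theorem theorem6p1 (R : realType) (d : nat) (n : 'I_d -> nat)
    (I : gsimage R n) (N : R) (DT DV : seq (lbar R)) :
  (0 < d)%N ->
  (forall i, (0 < n i)%N) ->
  max_over xpredT I < N ->
  is_dgm (Tfun I) DT ->
  is_dgm (Vfun (negim (pad I N))) DV ->
  perm_eq (dgm_fin DT)
    (rem (0 : int, (min_over xpredT I, N%:E))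
      [seq dual_lbar d x | x <- dgm_fin DV])
  /\ perm_eq (dgm_inf DT) [:: (0 : int, (min_over xpredT I, +oo%E))].
Proof.
move=> d_gt0 n_gt0 I_lt_N dgmT dgmV; split.
  exact: T_dgm_fin dgmT dgmV.
exact: T_dgm_inf dgmT.
Qed.
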